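(* Suppose that $\boldsymbol{\beta}\cdot\mathbf{n}=0$ on $\partial\Omega$, that $\boldsymbol{\beta}$ is divergence-free, and that the normal component of $\boldsymbol{\beta}$ is continuous across each interior edge of the mesh. Suppose further that, for each $n$, the viscosity matrix $V^n=(v_{ij}^n)\in\mathbb{R}^{N\times N}$ satisfies $v_{ij}^n=v_{ji}^n$ for all $i,j$ and $\sum_{j=1}^N v_{ij}^n=0$ for all $i$. Then the scheme $$U^{n+1}=\bigl(I-\Delta t^nM^{-1}(S^n-V^n)\bigr)U^n,\qquad n\ge0,$$ with arbitrary $U^0\in\mathbb{R}^N$ and $u_h^n=\sum_{i=1}^NU_i^n\varphi_i$, is conservative, i.e. $$\int_\Omega u_h^n\,\mathrm{d}\mathbf{x}=\int_\Omega u_h^0\,\mathrm{d}\mathbf{x}\qquad\text{for all } n\ge0 .$$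
   Context: Mesh and space. $\Omega\subset\mathbb{R}^2$ is an open (bounded) polygonal domain with outward unit normal $\mathbf{n}$, and $\mathcal{K}_h$ is a triangulation of $\Omega$ without hanging nodes. $\mathcal{F}_h^{\mathrm{int}}$ is the set of interior edges, and $\mathbf{x}_1,\dots,\mathbf{x}_N$ are the midpoints of all edges. For each edge $F$ a unit normal $\mathbf{n}_F$ is fixed; for a piecewise polynomial $v$ and $\mathbf{x}\in F\in\mathcal{F}_h^{\mathrm{int}}$ put $v^{\mp}(\mathbf{x})=\lim_{\epsilon\to0^+}v(\mathbf{x}\mp\epsilon\mathbf{n}_F)$ and $[\![v]\!]=v^+-v^-$. The Crouzeix-Raviart space $\mathcal{V}_h$ is the set of functions $v_h$ that are affine on each triangle and satisfy $\int_F[\![v_h]\!]\,\mathrm{d}s=0$ for all $F\in\mathcal{F}_h^{\mathrm{int}}$. Its basis $\varphi_1,\dots,\varphi_N$ is determined by $\varphi_i(\mathbf{x}_j)=\delta_{ij}$. $S_i$ is the support of $\varphi_i$. The mass matrix is diagonal: $M=\mathrm{diag}(m_1,\dots,m_N)$ with $m_i=\frac13|S_i|$. Velocity. $\boldsymbol{\beta}$ is a bounded velocity field, possibly time-dependent; at time level $n$ it is evaluated at $t=t^n$. It is understood to be regular enough to have traces on the triangle boundaries and to satisfy the divergence theorem on each triangle (against affine functions). Forms (at time $t^n$), where on $\partial K$ the vector $\mathbf{n}$ is the unit normal outward to $K$ and functions on $\partial K$ are traces from inside $K$: $$a_h(u_h,v_h)=\sum_{K\in\mathcal{K}_h}\int_K(\boldsymbol{\beta}\cdot\nabla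 u_h)\,v_h\,\mathrm{d}\mathbf{x},$$ $$b_h(u_h,v_h)=\sum_{K\in\mathcal{K}_h}\int_{\partial K\setminus\partial\Omega}\boldsymbol{\beta}\cdot\mathbf{n}\,u_hv_h\,\mathrm{d}s-\sum_{F\in\mathcal{F}_h^{\mathrm{int}}}\int_F\mathrm{Up}(u_h,\boldsymbol{\beta})\,(-[\![v_h]\!])\,\mathrm{d}s,$$ $$\mathrm{Up}(u_h,\boldsymbol{\beta})|_F=u_h^-\max(0,\boldsymbol{\beta}\cdot\mathbf{n}_F)+u_h^+\min(0,\boldsymbol{\beta}\cdot\mathbf{n}_F).$$ The matrix $S^n=(s_{ij}^n)$ is defined by $s_{ij}^n=a_h(\varphi_j,\varphi_i)-b_h(\varphi_j,\varphi_i)$. The time steps $\Delta t^n=t^{n+1}-t^n>0$ are arbitrary. *)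

(* Defs.v *)
From HB Require Import structures.
From mathcomp Require Import all_boot all_order all_algebra.
From mathcomp Require Import all_classical all_reals all_analysis.

Set Implicit Arguments.
Unset Strict Implicit.
Unset Printing Implicit Defensive.

Import Order.TTheory GRing.Theory Num.Theory.
Import numFieldNormedType.Exports.
Local Open Scope classical_set_scope.
Local Open Scope ring_scope.

Notation plane R := (R * R)%type.

Section Plane.
Context {R : realType}.
Implicit Types (x y a b d : plane R) (f g p : plane R -> R) (A : set (plane R)).

Definition dot x y : R := x.1 * y.1 + x.2 * y.2.

Definition along x (s : R) d : plane R := (x.1 + s * d.1, x.2 + s * d.2).

Definition enorm x : R := Num.sqrt (dot x x).

Definition segment a b : set (plane R) :=
  [set along a s (b - a) | s in `[0, 1]].

Definition bdry A : set (plane R) := closure A `\` interior A.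

Definition area : set (plane R) -> \bar R :=
  (lebesgue_measure \x lebesgue_measure)%E.

(* Integral, with respect to arc length, of f over the part of the segment
   [a, b] that lies in A; the two endpoints are left out, a null set. *)
Definition line_int a b A f : R :=
  enorm (b - a) *
  \int[lebesgue_measure]_(s in `]0, 1[ `&` [set s | A (along a s (b - a))])
    f (along a s (b - a)).

Definition ae_segment a b (P : plane R -> Prop) : Prop :=
  {ae lebesgue_measure, forall s : R, s \in `]0, 1[%R ->
    P (along a s (b - a))}.

(* One-sided limit of f at x along direction d: the limit of f (x + eps d) as
   eps tends to 0 from above. *)
Definition has_side_lim f x d : Prop :=
  cvg (f (along x e d) @[e --> 0^'+]).

Definition side_lim f x d : R := lim (f (along x e d) @[e --> 0^'+]).

Definition dx f x : R := derive1 (fun s => f (s, x.2)) x.1.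
Definition dy f x : R := derive1 (fun s => f (x.1, s)) x.2.
Definition grad f x : plane R := (dx f x, dy f x).

Definition affine p : Prop :=
  exists c0 c1 c2 : R, forall x, p x = c0 + c1 * x.1 + c2 * x.2.

Fixpoint Ck (k : nat) f : Prop :=
  continuous f /\
  if k is k'.+1 then
    [/\ forall x, derivable (fun s => f (s, x.2)) x.1 1 /\
                  derivable (fun s => f (x.1, s)) x.2 1,
        Ck k' (dx f) & Ck k' (dy f)]
  else True.

Definition test_function (G : set (plane R)) f : Prop :=
  (forall k, Ck k f) /\
  exists C : set (plane R),
    [/\ compact C, C `<=` G & forall x, ~ C x -> f x = 0].

(* d is the divergence of b in G in the sense of distributions. *)
Definition weak_divergence (G : set (plane R)) (b : plane R -> plane R)
    (d : plane R -> R) : Prop :=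
  area.-integrable G (EFin \o d) /\
  forall f, test_function G f ->
    \int[area]_(x in G) dot (b x) (grad f x) =
    - \int[area]_(x in G) (d x * f x).

End Plane.

(* interior (closure Omega) = Omega excludes cracks, along which midpoint
   values of a Crouzeix-Raviart function would not be single-valued. *)
Definition polygonal_domain {R : realType} (Omega : set (plane R)) : Prop :=
  [/\ open Omega, Omega !=set0, connected Omega,
      (exists C : R, forall x, Omega x -> enorm x <= C) &
      interior (closure Omega) = Omega /\
      exists sides : seq (plane R * plane R),
        bdry Omega = \bigcup_(ab in [set` sides]) segment ab.1 ab.2].

(* A triangle is the set of the indices of its three vertices. *)
Record mesh (R : realType) := Mesh {
  nvert : nat;
  vert : 'I_nvert -> plane R;
  tri : {set {set 'I_nvert}} }.

Section Mesh.
Context {R : realType}.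
Variable M : mesh R.
Implicit Types (K A : {set 'I_(nvert M)}) (F : 'I_(nvert M) * 'I_(nvert M)).
Implicit Types (u v p : plane R -> R) (x d : plane R).

Definition hull A : set (plane R) :=
  [set x | exists2 l : 'I_(nvert M) -> R,
     (forall a, 0 <= l a) /\ \sum_(a in A) l a = 1 &
     x = (\sum_(a in A) l a * (vert a).1, \sum_(a in A) l a * (vert a).2)].

Definition nondegenerate K : Prop :=
  forall a b c, a \in K -> b \in K -> c \in K -> uniq [:: a; b; c] ->
    ((vert b).1 - (vert a).1) * ((vert c).2 - (vert a).2)
    - ((vert b).2 - (vert a).2) * ((vert c).1 - (vert a).1) != 0.

(* The last clause expresses the absence of hanging nodes: two triangles meet in the
   convex hull of their common vertices (empty, a vertex or a full edge). *)
Definition triangulation (Omega : set (plane R)) : Prop :=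
  [/\ injective (@vert R M),
      forall K, K \in tri M -> #|K| = 3%N /\ nondegenerate K,
      closure Omega = \bigcup_(K in [set K | K \in tri M]) hull K &
      forall K K', K \in tri M -> K' \in tri M ->
        hull K `&` hull K' = hull (K :&: K')].

(* Open triangle; integrals over a triangle and gradients are taken there. *)
Definition cell K : set (plane R) := interior (hull K).

(* An edge is the pair of its endpoint indices, in increasing order. *)
Definition edge_of F K : bool :=
  [&& (F.1 < F.2)%N, F.1 \in K & F.2 \in K].

Definition edges : {set 'I_(nvert M) * 'I_(nvert M)} :=
  [set F | [exists K in tri M, edge_of F K]].

Definition interior_edges : {set 'I_(nvert M) * 'I_(nvert M)} :=
  [set F | [exists K in tri M, exists K' in tri M,
              [&& K != K', edge_of F K & edge_of F K']]].

Definition edge_vec F : plane R := vert F.2 - vert F.1.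

Definition edge_mid F : plane R := along (vert F.1) 2^-1 (edge_vec F).

Definition edge_int F (A : set (plane R)) (f : plane R -> R) : R :=
  line_int (vert F.1) (vert F.2) A f.

Definition ae_edge F (P : plane R -> Prop) : Prop :=
  ae_segment (vert F.1) (vert F.2) P.

Definition unit_normal F d : Prop :=
  dot d d = 1 /\ dot d (edge_vec F) = 0.

(* Outward unit normal to K on its edge F: the edge vector rotated by a right
   angle and normalized, with the sign for which K lies behind the edge. *)
Definition outward_normal K F : plane R :=
  let e := edge_vec F in
  let nu : plane R := (e.2 / enorm e, - e.1 / enorm e) in
  if [forall c in K, dot nu (vert c - vert F.1) <= 0] then nu else - nu.

(* Trace on the edge F from inside K. *)
Definition trace K F (f : plane R -> R) x : R :=
  side_lim f x (- outward_normal K F).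

Definition jump (nF : plane R) v x : R := side_lim v x nF - side_lim v x (- nF).

(* A piecewise affine function is determined off the union of the edges only;
   it is normalized to vanish there, and outside the mesh. *)
Definition piecewise_affine v : Prop :=
  (forall K, K \in tri M -> exists2 p, affine p &
    forall x, cell K x -> v x = p x) /\
  (forall x, (forall K, K \in tri M -> ~ cell K x) -> v x = 0).

Definition crouzeix_raviart
    (nrm : 'I_(nvert M) * 'I_(nvert M) -> plane R) v : Prop :=
  piecewise_affine v /\
  forall F, F \in interior_edges -> edge_int F setT (jump (nrm F) v) = 0.

(* Value of v at the midpoint of F: the common value of the traces from all
   the triangles having F as an edge. *)
Definition midpoint_value F v (c : R) : Prop :=
  forall K, K \in tri M -> edge_of F K -> trace K F v (edge_mid F) = c.

Definition nedges : nat := #|edges|.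

Definition edge (i : 'I_nedges) : 'I_(nvert M) * 'I_(nvert M) := enum_val i.

Definition cr_basis (nrm : 'I_(nvert M) * 'I_(nvert M) -> plane R)
    (phi : 'I_nedges -> plane R -> R) : Prop :=
  forall i, crouzeix_raviart nrm (phi i) /\
    forall j, midpoint_value (edge j) (phi i) (i == j)%:R.

Definition supp v : set (plane R) := closure [set x | v x != 0].

Definition lumped_mass (phi : 'I_nedges -> plane R -> R) : 'M[R]_nedges :=
  diag_mx (\row_i (fine (area (supp (phi i))) / 3)).

Section Velocity.
Variables (Omega : set (plane R)) (beta : plane R -> plane R).

Definition bounded_measurable : Prop :=
  [/\ measurable_fun Omega (fun x => (beta x).1),
      measurable_fun Omega (fun x => (beta x).2) &
      exists C : R, forall x, Omega x -> enorm (beta x) <= C].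

Definition vcomp d x : R := dot (beta x) d.

Definition normal_trace K F x : R :=
  trace K F (vcomp (outward_normal K F)) x.

(* Only the normal component is required to have traces; the limit is not
   automatically measurable along F, hence the integrability clause. *)
Definition has_normal_traces : Prop :=
  forall K F, K \in tri M -> edge_of F K ->
    ae_edge F (fun x => has_side_lim (vcomp (outward_normal K F)) x
                          (- outward_normal K F)) /\
    lebesgue_measure.-integrable `]0, 1[ (fun s =>
      (normal_trace K F (along (vert F.1) s (edge_vec F)))%:E).

(* Integral over the part of the boundary of K that lies in A. *)
Definition boundary_int K (A : set (plane R))
    (f : 'I_(nvert M) * 'I_(nvert M) -> plane R -> R) : R :=
  \sum_(F | edge_of F K) edge_int F A (f F).

Definition divergence_theorem : Prop :=
  forall K, K \in tri M -> forall dv, weak_divergence (cell K) beta dv ->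
  forall p, affine p ->
    boundary_int K setT (fun F x => normal_trace K F x * p x) =
    \int[area]_(x in cell K) dot (beta x) (grad p x) +
    \int[area]_(x in cell K) (dv x * p x).

(* Elementwise; the absence of a singular part of the divergence on interior
   edges is normal_continuous. *)
Definition divergence_free : Prop :=
  forall K, K \in tri M -> weak_divergence (cell K) beta (fun=> 0).

Definition normal_continuous
    (nrm : 'I_(nvert M) * 'I_(nvert M) -> plane R) : Prop :=
  forall F, F \in interior_edges ->
    ae_edge F (fun x => side_lim (vcomp (nrm F)) x (- nrm F) =
                        side_lim (vcomp (nrm F)) x (nrm F)).

(* beta . n = 0 on the boundary of Omega: at a boundary edge F of K, the
   outward normal to Omega is the outward normal to K. *)
Definition no_flux : Prop :=
  forall K F, K \in tri M -> edge_of F K ->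
    ae_edge F (fun x => bdry Omega x -> normal_trace K F x = 0).

Definition a_form u v : R :=
  \sum_(K in tri M) \int[area]_(x in cell K) (dot (beta x) (grad u x) * v x).

(* beta . nF on F is the trace from the side nF points away from; under
   normal_continuous the choice of the side is immaterial. *)
Definition upwind (nF : plane R) u x : R :=
  let bn := side_lim (vcomp nF) x (- nF) in
  side_lim u x (- nF) * Num.max 0 bn + side_lim u x nF * Num.min 0 bn.

Definition b_form (nrm : 'I_(nvert M) * 'I_(nvert M) -> plane R) u v : R :=
  \sum_(K in tri M) boundary_int K (~` bdry Omega)
     (fun F x => normal_trace K F x * trace K F u x * trace K F v x)
  - \sum_(F in interior_edges)
      edge_int F setT (fun x => upwind (nrm F) u x * - jump (nrm F) v x).

Definition stiffness (nrm : 'I_(nvert M) * 'I_(nvert M) -> plane R)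
    (phi : 'I_nedges -> plane R -> R) : 'M[R]_nedges :=
  \matrix_(i, j) (a_form (phi j) (phi i) - b_form nrm (phi j) (phi i)).

End Velocity.

Definition discrete_fun (phi : 'I_nedges -> plane R -> R)
    (U : 'cV[R]_nedges) x : R := \sum_i U i 0 * phi i x.

End Mesh.

(* Main.v *)
Require Import Defs.
From HB Require Import structures.
From mathcomp Require Import all_boot all_order all_algebra.
From mathcomp Require Import all_classical all_reals all_analysis measurable_realfun.
From mathcomp Require Import ring lra.
Set Implicit Arguments.
Unset Strict Implicit.
Unset Printing Implicit Defensive.
Import Order.TTheory GRing.Theory Num.Theory.
Import numFieldNormedType.Exports.
Local Open Scope classical_set_scope.
Local Open Scope ring_scope.

(** The scheme conserves the integral because of two facts about the basis.

    The first is that the diagonal of the lumped mass matrix consists of the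
    integrals of the basis functions, [lumped_massE] and
    [integral_discrete_fun], so that the integral of u_h is 1^T M U.  On a
    triangle the integral of an affine function is the area times the mean of
    its values at the edge midpoints, [integral_affine_cell]; hence phi_i
    contributes a third of the area of each triangle having the i-th edge, and
    these triangles make up its support.  The masses are positive, so M is
    invertible and multiplying the scheme by 1^T M leaves
    1^T M U^(n+1) = 1^T M U^n - dt 1^T (S - V) U^n.

    The second is that the columns of S sum to zero,
    [stiffness_column_sum].  On each triangle the basis functions sum to the
    constant 1, [sum_pieces], since this affine sum is 1 at the three
    midpoints.  Testing with the constant 1 turns a_h into the integrals of
    beta . grad phi_j, which the divergence theorem rewrites as boundary
    integrals of beta . n phi_j, as beta is divergence-free.  The first part of
    b_h becomes the same boundary integrals without the boundary of Omega,
    where beta . n vanishes.  The upwind part disappears, because the jump of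
    the constant 1 is zero.  The columns of V sum to zero too: V is symmetric
    and its rows do.

    The quadrature formula follows from a symmetry: the affine map that
    exchanges two vertices of a triangle and fixes the third has determinant
    -1, hence preserves area, and it exchanges two barycentric coordinates.
    The three coordinates therefore have the same integral, and they add up to
    1.  The rest is the geometry of the mesh: triangles and their interiors in
    barycentric coordinates, disjointness of the open triangles, and the fact
    that the two triangles at an interior edge lie on opposite sides of it, so
    that traces of piecewise affine functions are values of the affine
    pieces. *)

(** * Area of the plane under affine maps *)

(** Area as a bundled measure.  Its carrier is the product of the measurable
    type on which [lebesgue_measure] is a measure; the type [R * R] has the same
    measurable sets under another display, and facts pass between the two by
    conversion. *)
Definition plane_measure (R : realType) :
    {measure set (measurableTypeR R * measurableTypeR R) -> \bar R} :=
  (@lebesgue_measure R \x @lebesgue_measure R)%E.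

Section area_affine.
Context {R : realType}.
Implicit Types (A B : set (plane R)).

Lemma lebesgue_measure_affine (s c : R) (B : set R) :
  s != 0 -> measurable B ->
  lebesgue_measure ((fun y => s * y + c) @^-1` B) =
  (`|s|^-1%:E * lebesgue_measure B)%E.
Proof.
move=> s0 mB.
pose f : measurableTypeR R -> measurableTypeR R := fun y => s * y + c.
have mf : measurable_fun setT f.
  by apply: measurable_funD => //; exact: measurable_funM.
pose ss : {nonneg R} := NngNum (normr_ge0 s).
have H := @lebesgue_measure_unique R (mscale ss (pushforward lebesgue_measure f)).
have -> := H mf _ B mB; last first.
  move=> _ [[a b] _ <-] /=.
  rewrite /mscale /= /pushforward.
  have -> : f @^-1` `]a, b] = if 0 < s then `](a - c) / s, (b - c) / s]%classic
                              else `[(b - c) / s, (a - c) / s[%classic.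
    apply/seteqP; split => x /=; rewrite /f; case: ifPn => s1 /=;
    rewrite !in_itv /=.
    - by rewrite ltr_pdivrMr// ler_pdivlMr// mulrC ltrBlDr lerBrDr.
    - have {}s1 : s < 0 by rewrite lt_neqAle s0 leNgt.
      rewrite ltr_ndivlMr// ler_ndivrMr// [x * s]mulrC ltrBlDr lerBrDr.
      by rewrite andbC.
    - by rewrite ltr_pdivrMr// ler_pdivlMr// mulrC ltrBlDr lerBrDr.
    - have {}s1 : s < 0 by rewrite lt_neqAle s0 leNgt.
      rewrite ltr_ndivlMr// ler_ndivrMr// [x * s]mulrC ltrBlDr lerBrDr.
      by rewrite andbC.
  rewrite lebesgue_measure_itv /=; have [s1|s1] := boolP (0 < s).
    rewrite lebesgue_measure_itv/= !lte_fin ltr_pM2r ?invr_gt0// ltrD2r.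
    case: ifPn => ab; last by rewrite mule0.
    by rewrite -!EFinB -EFinM gtr0_norm//; congr EFin; field.
  have {}s1 : s < 0 by rewrite lt_neqAle s0 leNgt.
  rewrite lebesgue_measure_itv/= !lte_fin ltr_nM2r ?invr_lt0// ltrD2r.
  case: ifPn => ab; last by rewrite mule0.
  by rewrite -!EFinB -EFinM ltr0_norm//; congr EFin; field.
by rewrite /mscale /= muleA -EFinM mulVf ?normr_eq0// mul1e.
Qed.

Lemma le_area A B : measurable A -> measurable B -> A `<=` B ->
  (area A <= area B)%E.
Proof.
by move=> mA mB AB; apply: (@le_measure _ _ _ (plane_measure R)); rewrite ?inE.
Qed.

Lemma area_setU_le A B : measurable A -> measurable B ->
  (area (A `|` B) <= area A + area B)%E.
Proof. by move=> mA mB; exact: (@measureU2 _ _ _ (plane_measure R)). Qed.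

(** The vertical sections of the preimage are affine preimages of the vertical
    sections, so that the claim reduces to dimension one. *)
Lemma area_vertical_shear (s k c : R) A : s != 0 -> measurable A ->
  area ((fun p => (p.1, s * p.2 + k * p.1 + c)) @^-1` A) =
  (`|s|^-1%:E * area A)%E.
Proof.
move=> s0 mA.
have mA' : @measurable _ (measurableTypeR R * measurableTypeR R)%type A by [].
rewrite /area /product_measure1 -ge0_integralZl//; last first.
  exact: measurable_fun_xsection.
apply: eq_integral => x _ /=.
rewrite -(@lebesgue_measure_affine s (k * x + c))//; last first.
  exact: (measurable_xsection x mA').
congr (lebesgue_measure _); apply/seteqP; split => y /=;
by rewrite /xsection /= !inE /= addrA.
Qed.

Lemma area_swap A : measurable A ->
  area ((fun p => (p.2, p.1)) @^-1` A) = area A.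
Proof.
move=> mA.
pose s (p : measurableTypeR R * measurableTypeR R) := (p.2, p.1).
have ms : measurable_fun setT s by exact: measurable_fun_pair.
have H := @product_measure_unique _ _ (measurableTypeR R) (measurableTypeR R)
  R lebesgue_measure lebesgue_measure
  (pushforward (lebesgue_measure \x lebesgue_measure)%E s).
rewrite [RHS](H ms)// => B C mB mC.
rewrite /= /pushforward.
have -> : s @^-1` (B `*` C) = C `*` B.
  by apply/seteqP; split => -[x y] [].
by rewrite product_measure1E// muleC.
Qed.

Lemma measurable_preimage_affine (a b e c d f : R) A : measurable A ->
  measurable ((fun p : plane R =>
    (a * p.1 + b * p.2 + e, c * p.1 + d * p.2 + f)) @^-1` A).
Proof.
move=> mA; rewrite -[_ @^-1` _]setTI.
have m1 (k l n : R) :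
    measurable_fun setT (fun p : plane R => k * p.1 + l * p.2 + n).
  by do 2 apply: measurable_funD => //; apply: measurable_funM.
suff : measurable_fun setT (fun p : plane R =>
    (a * p.1 + b * p.2 + e, c * p.1 + d * p.2 + f)) by apply.
by apply: measurable_fun_pair.
Qed.

(** A matrix whose first entry is nonzero is a horizontal shear followed by a
    vertical one; otherwise the coordinates are exchanged first. *)
Lemma area_preimage_affine (a b e c d f : R) A :
  a * d - b * c != 0 -> measurable A ->
  area ((fun p : plane R =>
    (a * p.1 + b * p.2 + e, c * p.1 + d * p.2 + f)) @^-1` A) =
  (`|a * d - b * c|^-1%:E * area A)%E.
Proof.
have horiz (s k l : R) B : s != 0 -> measurable B ->
    area ((fun p => (s * p.1 + k * p.2 + l, p.2)) @^-1` B) =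
    (`|s|^-1%:E * area B)%E.
  move=> s0 mB.
  have mswap : measurable ((fun p : plane R => (p.2, p.1)) @^-1` B).
    have := measurable_preimage_affine 0 1 0 1 0 0 mB.
    congr (measurable _); apply/seteqP; split => -[x y] /=;
    by rewrite !mul0r !mul1r !addr0 add0r.
  rewrite -[in RHS](area_swap mB) -(area_vertical_shear k l s0)// -[RHS]area_swap.
    by congr area; apply/seteqP; split => -[x y].
  have := measurable_preimage_affine k s l 1 0 0 mB.
  congr (measurable _); apply/seteqP; split => -[x y] /=;
    by rewrite mul0r mul1r !addr0 [s * y + _]addrC.
have gen (a' b' e' c' d' f' : R) B : a' != 0 -> a' * d' - b' * c' != 0 ->
    measurable B ->
    area ((fun p : plane R =>
      (a' * p.1 + b' * p.2 + e', c' * p.1 + d' * p.2 + f')) @^-1` B) =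
    (`|a' * d' - b' * c'|^-1%:E * area B)%E.
  move=> a0 D0 mB.
  pose s := (a' * d' - b' * c') / a'.
  have s0 : s != 0 by rewrite mulf_neq0// invr_neq0.
  pose V (p : plane R) := (p.1, s * p.2 + c' / a' * p.1 + (f' - c' / a' * e')).
  have mV : measurable (V @^-1` B).
    have := measurable_preimage_affine 1 0 0 (c' / a') s (f' - c' / a' * e') mB.
    congr (measurable _); apply/seteqP; split => -[x y]; rewrite /V /=;
    by rewrite mul0r mul1r !addr0 [s * y + _]addrC.
  transitivity (area ((fun p => (a' * p.1 + b' * p.2 + e', p.2)) @^-1`
    (V @^-1` B))).
    congr area; apply/seteqP; split => -[x y] /=; rewrite /V /= /s;
    congr (B (_, _)); by field.
  rewrite horiz// area_vertical_shear// muleA -EFinM /s normrM normfV invfM invrK.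
  by rewrite mulrCA mulVf ?mulr1// normr_eq0.
move=> D0 mA; have [a0|a0] := eqVneq a 0; last exact: gen.
have b0 : b != 0 by apply: contraNneq D0 => ->; rewrite a0 !mul0r subrr.
have D' : b * c - a * d != 0 by rewrite -opprB oppr_eq0.
rewrite distrC; have <- := gen b a e d c f A b0 D' mA.
rewrite -[RHS]area_swap; last exact: measurable_preimage_affine.
by congr area; apply/seteqP; split => -[x y] /=;
  rewrite [b * y + _]addrC [d * y + _]addrC.
Qed.

(** A line is the preimage of the vertical axis under an affine bijection. *)
Lemma area_line (c0 c1 c2 : R) : (c1 != 0) || (c2 != 0) ->
  area [set x : plane R | c0 + c1 * x.1 + c2 * x.2 = 0] = 0%E.
Proof.
move=> c12.
(* the second row of the map is orthogonal to the first, which makes its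
   determinant the squared norm of the normal to the line *)
have D0 : c1 * c1 - c2 * - c2 != 0.
  rewrite mulrN opprK -!expr2 paddr_eq0 ?sqr_ge0// !sqrf_eq0.
  by rewrite negb_and.
have mline : measurable ([set 0 : R] `*` [set: R]) by exact: measurableX.
transitivity (area ((fun p : plane R =>
    (c1 * p.1 + c2 * p.2 + c0, - c2 * p.1 + c1 * p.2 + 0)) @^-1`
    ([set 0] `*` setT))).
  congr area; apply/seteqP; split => -[x y] /=.
    by move=> H; split => //; rewrite -H; ring.
  by case=> H _; rewrite -H; ring.
rewrite area_preimage_affine// [X in (_ * X)%E](_ : _ = 0%E) ?mule0//.
have := @product_measure1E _ _ (measurableTypeR R) (measurableTypeR R) R
  lebesgue_measure lebesgue_measure [set 0] setT.
move=> /(_ (measurable_set1 0) measurableT) H.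
apply: (eq_trans H); rewrite [X in (X * _)%E](_ : _ = 0%E) ?mul0e//.
exact: lebesgue_measure_set1.
Qed.

Lemma area_box (a b c d : R) :
  area (`[a, b] `*` `[c, d]) =
  (lebesgue_measure `[a, b] * lebesgue_measure `[c, d])%E.
Proof.
exact: (@product_measure1E _ _ (measurableTypeR R) (measurableTypeR R)).
Qed.

(** An open set is the countable union of the rational squares inside it. *)
Lemma measurable_open_plane A : open A -> measurable A.
Proof.
move=> oA.
pose B (q : rat * rat * rat) : set (plane R) :=
  `](ratr q.1.1 - ratr q.2), (ratr q.1.1 + ratr q.2)[ `*`
  `](ratr q.1.2 - ratr q.2), (ratr q.1.2 + ratr q.2)[.
pose F q := if pselect (B q `<=` A) then B q else set0.
have -> : A = \bigcup_q F q.
  apply/seteqP; split => [x Ax|x [q _]]; last first.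
    by rewrite /F; case: pselect => [BA /BA|].
  have /nbhs_ballP[e e0 eA] : nbhs x A by exact: open_nbhs_nbhs.
  have e20 : 0 < e / 4 by rewrite divr_gt0.
  have [r] := @rat_in_itvoo R _ _ e20.
  rewrite in_itv/= => /andP[r0 re].
  have near (z : R) : exists q : rat, `|z - ratr q| < ratr r.
    have [q] := @rat_in_itvoo R (z - ratr r) (z + ratr r) ltac:(lra).
    by rewrite in_itv/= => /andP[q1 q2]; exists q; rewrite ltr_norml; lra.
  have [q1 Hq1] := near x.1; have [q2 Hq2] := near x.2.
  exists (q1, q2, r) => //; rewrite /F; case: pselect => [?|[]] //.
    by split; rewrite /= in_itv/=; move: Hq1 Hq2; rewrite !ltr_norml; lra.
  move=> y [] /=; rewrite !in_itv/= => y1 y2; apply: eA.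
  by move: Hq1 Hq2; rewrite !ltr_norml => Hq1 Hq2; split => /=;
    rewrite /ball/= ltr_norml; lra.
apply: countable_bigcupT_measurable => [|q]; first exact: countableP.
rewrite /F; case: pselect => ? /=; last exact: measurable0.
by apply: measurableX; exact: measurable_itv.
Qed.

End area_affine.

(** * Affine functions *)
Section affine_functions.
Context {R : realType}.
Implicit Types (x y d A B C : plane R) (p q : plane R -> R).

Lemma affine_cst (c : R) : affine (fun=> c : R).
Proof. by exists c, 0, 0 => x; rewrite !mul0r !addr0. Qed.

Lemma affine_fst : affine (fun x : plane R => x.1).
Proof. by exists 0, 1, 0 => x; rewrite mul1r mul0r add0r addr0. Qed.

Lemma affine_snd : affine (fun x : plane R => x.2).
Proof. by exists 0, 0, 1 => x; rewrite mul1r mul0r !add0r. Qed.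

Lemma affineD p q : affine p -> affine q -> affine (fun x => p x + q x).
Proof.
move=> [a0 [a1 [a2 pE]]] [b0 [b1 [b2 qE]]].
by exists (a0 + b0), (a1 + b1), (a2 + b2) => x; rewrite pE qE; ring.
Qed.

Lemma affineZ (c : R) p : affine p -> affine (fun x => c * p x).
Proof.
move=> [a0 [a1 [a2 pE]]].
by exists (c * a0), (c * a1), (c * a2) => x; rewrite pE; ring.
Qed.

Lemma affine_sum (I : Type) (r : seq I) (P : pred I) (F : I -> plane R -> R) :
  (forall i, P i -> affine (F i)) -> affine (fun x => \sum_(i <- r | P i) F i x).
Proof.
move=> aF; elim: r => [|i r IH].
  suff -> : (fun x => \sum_(i <- [::] | P i) F i x) = fun=> 0.
    exact: affine_cst.
  by apply/funext => x; rewrite big_nil.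
suff -> : (fun x => \sum_(j <- i :: r | P j) F j x) = (fun x : plane R =>
    (if P i then F i x else 0) + \sum_(j <- r | P j) F j x).
  by apply: affineD => //; have [/aF|_] := boolP (P i) => //; exact: affine_cst.
by apply/funext => x; rewrite big_cons; case: ifP => //; rewrite add0r.
Qed.

(** [p d - p 0] is the linear part of [p] applied to [d]. *)
Lemma affine_along p x (s : R) d : affine p ->
  p (along x s d) = p x + s * (p d - p 0).
Proof. by move=> [a0 [a1 [a2 pE]]]; rewrite !pE /=; ring. Qed.

Lemma affine_segment p A B (s : R) : affine p ->
  p (along A s (B - A)) = (1 - s) * p A + s * p B.
Proof. by move=> [a0 [a1 [a2 pE]]]; rewrite !pE /=; ring. Qed.

Lemma measurable_affine p (D : set (plane R)) : affine p -> measurable_fun D p.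
Proof.
move=> [a0 [a1 [a2 pE]]].
rewrite (_ : p = fun x => a0 + a1 * x.1 + a2 * x.2); last exact/funext.
apply: measurable_funTS.
by apply: measurable_funD; [apply: measurable_funD => //|];
  apply: measurable_funM.
Qed.

Lemma continuous_affine p : affine p -> continuous p.
Proof.
move=> [a0 [a1 [a2 pE]]] x.
rewrite (_ : p = fun x => a0 + a1 * x.1 + a2 * x.2); last exact/funext.
have c1 : z.1 @[z --> x] --> x.1 by case: x => u v; exact: cvg_fst.
have c2 : z.2 @[z --> x] --> x.2 by case: x {c1} => u v; exact: cvg_snd.
apply: (@cvgD _ _ _ _ _ (fun x : plane R => a0 + a1 * x.1)
  (fun x : plane R => a2 * x.2)).
  apply: (@cvgD _ _ _ _ _ (fun=> a0) (fun x : plane R => a1 * x.1)).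
    exact: cvg_cst.
  exact: (cvgM (cvg_cst a1) c1).
exact: (cvgM (cvg_cst a2) c2).
Qed.

(** The difference quotients of an affine function do not depend on the point,
    hence neither do their limits. *)
Lemma grad_affine p x : affine p -> grad p x = grad p 0.
Proof.
move=> [a0 [a1 [a2 pE]]]; rewrite /grad /dx /dy /derive1; congr pair.
  by apply: (congr1 (fun g : R -> R => lim (g @ 0^'))); apply/funext => h;
     rewrite !pE /=; congr (_ *: _); ring.
by apply: (congr1 (fun g : R -> R => lim (g @ 0^'))); apply/funext => h;
     rewrite !pE /=; congr (_ *: _); ring.
Qed.

Lemma continuous_along x d : continuous (fun s : R => along x s d).
Proof.
move=> s; have h (a b : R) : a + e * b @[e --> s] --> a + s * b.
  exact: (cvgD (cvg_cst a) (cvgM (@cvg_id _ (nbhs s)) (cvg_cst b))).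
exact: (cvg_pair (h x.1 d.1) (h x.2 d.2)).
Qed.

Lemma cvg_along x d : along x e d @[e --> (0 : R)] --> x.
Proof.
have x0 : along x 0 d = x by rewrite /along !mul0r !addr0 -surjective_pairing.
by have := @continuous_along x d 0; rewrite /continuous_at x0.
Qed.

Lemma near_along (S : set (plane R)) x d : nbhs x S ->
  \forall e \near 0^'+, S (along x e d).
Proof.
by move=> xS; exact: (cvg_at_right_filter (@cvg_along x d) xS).
Qed.

End affine_functions.

(** * Triangles in barycentric coordinates *)
Section triangle.
Context {R : realType}.
Implicit Types (A B C x d : plane R) (p : plane R -> R).

(** Twice the signed area of the triangle [A B C]. *)
Definition orient A B C : R :=
  (B.1 - A.1) * (C.2 - A.2) - (B.2 - A.2) * (C.1 - A.1).

(** The barycentric coordinate of [x] attached to the vertex [A]. *)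
Definition bary A B C x : R := orient x B C / orient A B C.

Definition open_triangle A B C : set (plane R) :=
  [set x | [/\ 0 < bary A B C x, 0 < bary B C A x & 0 < bary C A B x]].

Definition closed_triangle A B C : set (plane R) :=
  [set x | [/\ 0 <= bary A B C x, 0 <= bary B C A x & 0 <= bary C A B x]].

Lemma orient_rot A B C : orient B C A = orient A B C.
Proof. by rewrite /orient; ring. Qed.

Lemma orient_swap A B C : orient B A C = - orient A B C.
Proof. by rewrite /orient; ring. Qed.

Lemma affine_bary A B C : affine (bary A B C).
Proof.
exists ((B.1 * C.2 - B.2 * C.1) / orient A B C),
  ((B.2 - C.2) / orient A B C), ((C.1 - B.1) / orient A B C) => x.
by rewrite /bary /orient; ring.
Qed.

Lemma open_triangle_rot A B C : open_triangle B C A = open_triangle A B C.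
Proof. by apply/seteqP; split => x [? ? ?]. Qed.

Section nondegenerate.
Variables (A B C : plane R).
Hypothesis ABC : orient A B C != 0.

Let BCA : orient B C A != 0. Proof. by rewrite orient_rot. Qed.
Let CAB : orient C A B != 0. Proof. by rewrite -orient_rot. Qed.

Lemma bary_vertices :
  [/\ bary A B C A = 1, bary A B C B = 0 & bary A B C C = 0].
Proof.
split; rewrite /bary ?divff// [X in X / _](_ : _ = 0) ?mul0r// /orient; ring.
Qed.

Lemma bary_sum x : bary A B C x + bary B C A x + bary C A B x = 1.
Proof.
rewrite /bary [orient B C A]orient_rot -[orient C A B]orient_rot -!mulrDl.
by rewrite -[RHS](divff ABC); congr (_ / _); rewrite /orient; ring.
Qed.

Lemma affine_barycentric p x : affine p ->
  p x = p A * bary A B C x + p B * bary B C A x + p C * bary C A B x.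
Proof.
move=> [a0 [a1 [a2 pE]]]; rewrite /bary [orient B C A]orient_rot.
rewrite -[orient C A B]orient_rot !mulrA -!mulrDl.
by apply: (mulIf ABC); rewrite divfK// !pE /orient; ring.
Qed.

Lemma affine_triangle_bound p x : affine p -> closed_triangle A B C x ->
  `|p x| <= `|p A| + `|p B| + `|p C|.
Proof.
move=> ap [a0 b0 c0]; rewrite (affine_barycentric x ap).
have := bary_sum x => s1.
have le1 (u v : R) : 0 <= v -> v <= 1 -> `|u * v| <= `|u|.
  by move=> v0 v1; rewrite normrM (ger0_norm v0) ler_piMr.
apply: (le_trans (ler_normD _ _)); apply: lerD; last by apply: le1 => //; lra.
by apply: (le_trans (ler_normD _ _)); apply: lerD; apply: le1 => //; lra.
Qed.

Lemma open_triangle_sub : open_triangle A B C `<=` closed_triangle A B C.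
Proof. by move=> x [? ? ?]; split; exact: ltW. Qed.

End nondegenerate.

Lemma open_affine_gt0 p : affine p -> open [set x | 0 < p x].
Proof.
move=> ap; apply: (@open_comp _ _ p [set s | 0 < s]); last exact: open_gt.
by move=> x _; exact: continuous_affine.
Qed.

Lemma open_open_triangle A B C : open (open_triangle A B C).
Proof.
rewrite (_ : open_triangle A B C = [set x | 0 < bary A B C x] `&`
  ([set x | 0 < bary B C A x] `&` [set x | 0 < bary C A B x])).
  by do 2! (apply: openI; first by apply: open_affine_gt0; exact: affine_bary);
    apply: open_affine_gt0; exact: affine_bary.
by apply/seteqP; split => [x [? ? ?]|x [? [? ?]]]; split.
Qed.

Lemma measurable_open_triangle A B C : measurable (open_triangle A B C).
Proof. by apply: measurable_open_plane; exact: open_open_triangle. Qed.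

Lemma closed_affine_ge0 p : affine p -> closed [set x | 0 <= p x].
Proof.
move=> ap; apply: (@preimage_closed _ _ p [set s | 0 <= s]); last exact: closed_ge.
by move=> x _; exact: continuous_affine.
Qed.

Lemma closed_closed_triangle A B C : closed (closed_triangle A B C).
Proof.
rewrite (_ : closed_triangle A B C = [set x | 0 <= bary A B C x] `&`
  ([set x | 0 <= bary B C A x] `&` [set x | 0 <= bary C A B x])).
  by do 2! (apply: closedI; first by apply: closed_affine_ge0; exact: affine_bary);
    apply: closed_affine_ge0; exact: affine_bary.
by apply/seteqP; split => [x [? ? ?]|x [? [? ?]]]; split.
Qed.

Lemma measurable_closed_triangle A B C : measurable (closed_triangle A B C).
Proof.
rewrite -[closed_triangle A B C]setCK; apply: measurableC.
apply: measurable_open_plane; apply: closed_openC.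
exact: closed_closed_triangle.
Qed.

(** A nonempty open set contains a nondegenerate square. *)
Lemma open_area_gt0 (S : set (plane R)) : open S -> S !=set0 -> (0 < area S)%E.
Proof.
move=> oS [x Sx]; have /nbhs_ballP[e /= e0 eS] : nbhs x S by exact: open_nbhs_nbhs.
pose D : set (plane R) := `[x.1, x.1 + e / 2] `*` `[x.2, x.2 + e / 2].
apply: (@lt_le_trans _ _ (area D)).
  by rewrite area_box !lebesgue_measure_itv/= !lte_fin !ltrDl divr_gt0//=
    -!EFinB mule_gt0// lte_fin; lra.
apply: le_area; first by apply: measurableX; exact: measurable_itv.
  exact: measurable_open_plane.
move=> y [] /=; rewrite !in_itv/= => y1 y2; apply: eS.
by split => /=; rewrite /ball/= ltr_norml; lra.
Qed.

(** The zero set of a nonconstant affine function is a line. *)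
Lemma area_affine_eq0 p (u v : plane R) : affine p -> p u != p v ->
  area [set x | p x = 0] = 0%E.
Proof.
move=> [a0 [a1 [a2 pE]]] uv.
rewrite (_ : [set x | p x = 0] = [set x | a0 + a1 * x.1 + a2 * x.2 = 0]).
  apply: area_line; apply: contraNT uv; rewrite negb_or !negbK => /andP[/eqP a10 /eqP a20].
  by rewrite !pE a10 a20 !mul0r.
by apply/seteqP; split => x /=; rewrite pE.
Qed.

Lemma measurable_affine_eq0 p : affine p -> measurable [set x | p x = 0].
Proof.
move=> ap; rewrite (_ : [set x | p x = 0] = setT `&` p @^-1` [set 0]).
  by apply: (measurable_affine ap) => //; exact: measurable_set1.
by apply/seteqP; split => x //= [].
Qed.

End triangle.

Lemma bounded_integrable d (T : measurableType d) (R : realType)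
    (mu : {measure set T -> \bar R}) (D : set T) (f : T -> R) (M : R) :
  measurable D -> (mu D < +oo)%E -> measurable_fun D f ->
  (forall x, D x -> `|f x| <= M) -> mu.-integrable D (EFin \o f).
Proof.
move=> mD fD mf fM; apply: measurable_bounded_integrable => //.
exists M; split; first exact: num_real.
by move=> y My x Dx; apply: (le_trans (fM _ Dx)); exact: ltW.
Qed.

(** * Quadrature on a triangle *)
Section triangle_integral.
Context {R : realType}.
Variables (A B C : plane R).
Hypothesis ABC : orient A B C != 0.
Implicit Types (x : plane R) (p : plane R -> R).

Notation T := (open_triangle A B C).

Lemma area_open_triangle_lty : (area T < +oo)%E.
Proof.
pose m1 : R := `|A.1| + `|B.1| + `|C.1|.
pose m2 : R := `|A.2| + `|B.2| + `|C.2|.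
apply: (@le_lt_trans _ _ (area (`[- m1, m1] `*` `[- m2, m2]))).
  apply: le_area; first exact: measurable_open_triangle.
    by apply: measurableX; exact: measurable_itv.
  move=> x /open_triangle_sub Tx; split; rewrite /= in_itv/= -ler_norml.
    exact: (affine_triangle_bound ABC affine_fst Tx).
  exact: (affine_triangle_bound ABC affine_snd Tx).
by rewrite area_box !lebesgue_measure_itv/=; do 2 case: ifP => _;
  rewrite -?EFinB ?mule0 ?mul0e// -EFinM ltry.
Qed.

Lemma area_open_triangle_gt0 : (0 < area T)%E.
Proof.
apply: open_area_gt0; first exact: open_open_triangle.
pose G : plane R := ((A.1 + B.1 + C.1) / 3, (A.2 + B.2 + C.2) / 3).
have c (U V W : plane R) : orient U V W != 0 ->
    (U.1 + V.1 + W.1) / 3 = G.1 -> (U.2 + V.2 + W.2) / 3 = G.2 ->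
    0 < bary U V W G.
  move=> UVW G1 G2; rewrite /bary (_ : orient _ V W = orient U V W / 3).
    by rewrite mulrAC divff// mul1r invr_gt0.
  by rewrite /orient -G1 -G2; field.
exists G; split; apply: c; rewrite /G/=.
- exact: ABC.
- by [].
- by [].
- by rewrite orient_rot.
- by congr (_ / _); ring.
- by congr (_ / _); ring.
- by rewrite -orient_rot.
- by congr (_ / _); ring.
- by congr (_ / _); ring.
Qed.

Lemma integrable_affine_triangle p : affine p ->
  (@plane_measure R).-integrable T (EFin \o p).
Proof.
move=> ap; apply: (@bounded_integrable _ _ _ _ _ _ (`|p A| + `|p B| + `|p C|)).
- exact: measurable_open_triangle.
- exact: area_open_triangle_lty.
- exact: measurable_affine.
- by move=> x /open_triangle_sub; exact: affine_triangle_bound.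
Qed.

(** The boundary of a triangle lies on the three lines where a barycentric
    coordinate vanishes. *)
Lemma area_closed_triangle : area (closed_triangle A B C) = area T.
Proof.
have null (U V W : plane R) : orient U V W != 0 ->
    area [set x | bary U V W x = 0] = 0%E.
  move=> UVW; apply: (@area_affine_eq0 _ _ U V); first exact: affine_bary.
  by have [-> -> _] := bary_vertices UVW; exact: oner_neq0.
have mb (U V W : plane R) : measurable [set x | bary U V W x = 0].
  by apply: measurable_affine_eq0; exact: affine_bary.
have BCA : orient B C A != 0 by rewrite orient_rot.
have CAB : orient C A B != 0 by rewrite -orient_rot.
have mT := measurable_open_triangle A B C.
have mT' := measurable_closed_triangle A B C.
apply/eqP; rewrite eq_le; apply/andP; split; last first.
  by apply: le_area => //; exact: open_triangle_sub.
pose L := [set x | bary A B C x = 0] `|` ([set x | bary B C A x = 0] `|`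
   [set x | bary C A B x = 0]).
have mL : measurable L by do 2 apply: measurableU => //.
have aL : area L = 0%E.
  apply/eqP; rewrite -measure_le0; apply: (le_trans (area_setU_le _ _)) => //.
    exact: measurableU.
  rewrite [X in (X + _)%E](null _ _ _ ABC) add0e.
  apply: (le_trans (area_setU_le _ _)) => //.
  by rewrite [X in (X + _)%E](null _ _ _ BCA) add0e
    [X in (X <= _)%E](null _ _ _ CAB).
apply: (@le_trans _ _ (area (T `|` L))).
  apply: le_area => //; first exact: measurableU.
  move=> x [a0 b0 c0].
  have [a1|a1] := eqVneq (bary A B C x) 0; first by right; left.
  have [b1|b1] := eqVneq (bary B C A x) 0; first by right; right; left.
  have [c1|c1] := eqVneq (bary C A B x) 0; first by right; right; right.
  by left; split; rewrite lt_def ?a1 ?b1 ?c1.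
by apply: (le_trans (area_setU_le _ _)) => //; rewrite [X in (_ + X)%E]aL adde0.
Qed.

Lemma area_triangle_neq0 p (u v : plane R) : affine p -> p u != p v ->
  area (T `&` [set x | p x != 0]) = area T.
Proof.
move=> ap uv; have mT := measurable_open_triangle A B C.
have m0 := measurable_affine_eq0 ap.
have eqD : T `&` [set x | p x != 0] = T `\` [set x | p x = 0].
  by apply/seteqP; split => x [Tx /eqP].
have mD : measurable (T `&` [set x | p x != 0]).
  by rewrite eqD; exact: measurableD.
apply/eqP; rewrite eq_le; apply/andP; split.
  by apply: le_area => //; exact: subIsetl.
apply: (@le_trans _ _ (area ((T `&` [set x | p x != 0]) `|` [set x | p x = 0]))).
  apply: le_area => //; first exact: measurableU.
  by move=> x Tx; have [p0|p0] := eqVneq (p x) 0; [right|left].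
by apply: (le_trans (area_setU_le _ _)) => //;
  rewrite [X in (_ + X)%E](area_affine_eq0 ap uv) adde0.
Qed.

(** Change of variables: the integral over the preimage is the integral against
    the image measure, which is the area again. *)
Lemma Rintegral_area_preserving (S : plane R -> plane R) (D : set (plane R))
    (f : plane R -> R) :
  measurable_fun setT S ->
  (forall Y, measurable Y -> area (S @^-1` Y) = area Y) ->
  measurable D -> measurable_fun D f -> (forall x, D x -> 0 <= f x) ->
  \int[area]_(x in S @^-1` D) f (S x) = \int[area]_(x in D) f x.
Proof.
move=> mS areaS mD mf f0; congr fine.
pose P : measurableType _ := (measurableTypeR R * measurableTypeR R)%type.
have mfE : @measurable_fun _ _ P _ D (EFin \o f) by apply/measurable_EFinP.
have f0E : {in D, forall y, (0 <= (EFin \o f) y)%E}.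
  by move=> x; rewrite inE lee_fin; exact: f0.
have mSP : @measurable_fun _ _ P P setT S := mS.
have mDP : @measurable _ P D := mD.
apply: (eq_trans (esym
  (ge0_integral_pushforward mSP (plane_measure R) mDP mfE f0E))).
by apply: eq_measure_integral => Y mY _; exact: areaS.
Qed.

(** The affine involution that exchanges [A] and [B] and fixes [C] preserves
    area and the triangle, and exchanges the two coordinates. *)
Lemma integral_bary_swap :
  \int[area]_(x in T) bary A B C x = \int[area]_(x in T) bary B C A x.
Proof.
pose D := orient A B C.
pose e1 := B.1 - A.1. pose e2 := B.2 - A.2.
pose u1 := (B.2 + A.2 - C.2 *+ 2) / D.
pose u2 := (C.1 *+ 2 - B.1 - A.1) / D.
pose u0 := (B.1 * C.2 - B.2 * C.1 - (C.1 * A.2 - C.2 * A.1)) / D.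
(* S moves x along B - A by the difference of the coordinates of A and B; that
   difference is u0 + u1 x_1 + u2 x_2 *)
pose S (x : plane R) : plane R := ((1 + u1 * e1) * x.1 + u2 * e1 * x.2 + u0 * e1,
  u1 * e2 * x.1 + (1 + u2 * e2) * x.2 + u0 * e2).
have detS : (1 + u1 * e1) * (1 + u2 * e2) - u2 * e1 * (u1 * e2) = -1.
  have ue : u1 * e1 + u2 * e2 = -2.
    rewrite /u1 /u2 ![_ / D * _]mulrAC -mulrDl; apply: (mulIf ABC).
    by rewrite divfK// /e1 /e2 /orient; ring.
  transitivity (1 + (u1 * e1 + u2 * e2)); first by ring.
  by rewrite ue; ring.
have SE x : S x = along x (bary A B C x - bary B C A x) (B - A).
  have -> : bary A B C x - bary B C A x = u0 + u1 * x.1 + u2 * x.2.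
    rewrite /bary [orient B C A]orient_rot -/D -mulrBl /u0 /u1 /u2.
    by rewrite ![_ / D * _]mulrAC -!mulrDl /orient; congr (_ / _); ring.
  by rewrite /S /along /= /e1 /e2; congr pair; ring.
have SP p x : affine p -> p (S x) =
    p x + (bary A B C x - bary B C A x) * (p B - p A).
  move=> ap; rewrite SE affine_along//; congr (_ + _ * _).
  by case: ap => [a0 [a1 [a2 pE]]]; rewrite !pE /=; ring.
have [aA aB aC] := bary_vertices ABC.
have BCA : orient B C A != 0 by rewrite orient_rot.
have CAB : orient C A B != 0 by rewrite -orient_rot.
have [bB bC bA] := bary_vertices BCA.
have [cC cA cB] := bary_vertices CAB.
have SA x : bary A B C (S x) = bary B C A x.
  by rewrite SP ?aA ?aB; [ring|exact: affine_bary].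
have SB x : bary B C A (S x) = bary A B C x.
  by rewrite SP ?bA ?bB; [ring|exact: affine_bary].
have SC x : bary C A B (S x) = bary C A B x.
  by rewrite SP ?cA ?cB; [ring|exact: affine_bary].
have mT := measurable_open_triangle A B C.
have mS : measurable_fun setT S.
  by move=> _ Y mY; rewrite setTI; exact: measurable_preimage_affine.
have areaS Y : measurable Y -> area (S @^-1` Y) = area Y.
  move=> mY; rewrite area_preimage_affine ?detS ?oppr_eq0 ?oner_neq0//.
  by rewrite normrN1 invr1 mul1e.
have ST : S @^-1` T = T.
  by apply/seteqP; split => x []; rewrite /= ?SA ?SB ?SC => ? ? ?; split;
   rewrite ?SA ?SB ?SC.
rewrite -[RHS](Rintegral_area_preserving mS areaS mT).
- by rewrite ST; apply: eq_Rintegral => x _; rewrite SB.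
- exact: measurable_affine (affine_bary _ _ _).
- by move=> x [_ /ltW].
Qed.

End triangle_integral.

Section quadrature.
Context {R : realType}.
Variables (A B C : plane R).
Hypothesis ABC : orient A B C != 0.

Lemma integral_affine_triangle (p : plane R -> R) : affine p ->
  \int[area]_(x in open_triangle A B C) p x =
  fine (area (open_triangle A B C)) / 3 * (p A + p B + p C).
Proof.
move=> ap.
have BCA : orient B C A != 0 by rewrite orient_rot.
have mT := measurable_open_triangle A B C.
have iT q : affine q ->
    (@plane_measure R).-integrable (open_triangle A B C) (EFin \o q).
  by move=> aq; exact: integrable_affine_triangle.
have ab := affine_bary A B C; have bc := affine_bary B C A.
have ca := affine_bary C A B.
set I := \int[area]_(x in open_triangle A B C) bary A B C x.
have IB : \int[area]_(x in open_triangle A B C) bary B C A x = I.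
  by rewrite -integral_bary_swap.
have IC : \int[area]_(x in open_triangle A B C) bary C A B x = I.
  have := integral_bary_swap BCA.
  by rewrite open_triangle_rot IB.
have lin (a b c : R) : \int[area]_(x in open_triangle A B C)
    (a * bary A B C x + b * bary B C A x + c * bary C A B x) = I * (a + b + c).
  rewrite RintegralD//; last 2 first.
  - by apply: iT; apply: affineD; exact: affineZ.
  - by apply: iT; exact: affineZ.
  rewrite RintegralD//; [|by apply: iT; exact: affineZ..].
  rewrite !RintegralZl//; [|exact: iT..].
  by rewrite IB IC -/I; ring.
have -> : \int[area]_(x in open_triangle A B C) p x = I * (p A + p B + p C).
  by rewrite -lin; apply: eq_Rintegral => x _; exact: affine_barycentric.
(* the three coordinates sum to 1, whose integral is the area *)
suff -> : fine (area (open_triangle A B C)) = I * 3 by rewrite mulfK.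
transitivity (I * (1 + 1 + 1)); last by ring.
rewrite -lin -[LHS]mul1r -Rintegral_cst//.
by apply: eq_Rintegral => x _; rewrite !mul1r bary_sum.
Qed.

End quadrature.

(** * Triangles of a mesh *)
Section triangulation_geometry.
Context {R : realType} (M : mesh R).
Implicit Types (K A : {set 'I_(nvert M)}) (F : 'I_(nvert M) * 'I_(nvert M)).
Implicit Types (a b c : 'I_(nvert M)) (x d : plane R) (p : plane R -> R).

(** Enumerates the vertices of [K] so that the results on triangles given by
    three points apply. *)
Definition spans K a b c : Prop :=
  K = [set a; b; c]%SET /\ orient (vert a) (vert b) (vert c) != 0.

Lemma spans_rot K a b c : spans K a b c -> spans K b c a.
Proof.
move=> [-> o]; split; last by rewrite orient_rot.
by apply/setP => i; rewrite !inE; case: (i == a) (i == b) (i == c) => [] [] [].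
Qed.

Lemma spans_swap K a b c : spans K a b c -> spans K b a c.
Proof.
move=> [-> o]; split; last by rewrite orient_swap oppr_eq0.
by apply/setP => i; rewrite !inE; case: (i == a) (i == b) => [] [].
Qed.

Lemma spans_neq K a b c : spans K a b c -> [/\ a != b, b != c & a != c].
Proof.
by move=> [_ o]; split; apply: contra_neq o => ->; rewrite /orient; ring.
Qed.

Lemma sum_spans K a b c (f : 'I_(nvert M) -> R) : spans K a b c ->
  \sum_(i in K) f i = f a + f b + f c.
Proof.
move=> sK; have [ab bc ac] := spans_neq sK; case: sK => -> _.
rewrite (big_setD1 c) ?inE ?eqxx ?orbT//= addrC; congr (_ + _).
rewrite (_ : _ :\ c = [set a; b])%SET; first by rewrite big_setU1 ?inE//= big_set1.
apply/setP => i; rewrite !inE; have [->|] := eqVneq i c; last by rewrite orbF.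
by rewrite ![c == _]eq_sym (negbTE bc) (negbTE ac).
Qed.

Lemma affine_hull p A x : affine p -> hull A x ->
  exists l : 'I_(nvert M) -> R,
  [/\ forall a, 0 <= l a, \sum_(a in A) l a = 1 &
      p x = \sum_(a in A) l a * p (vert a)].
Proof.
move=> [a0 [a1 [a2 pE]]] [l [l0 l1] xE]; exists l; split => //.
rewrite xE pE /=.
have -> : \sum_(a in A) l a * p (vert a) = \sum_(a in A)
    (l a * a0 + l a * (a1 * (vert a).1) + l a * (a2 * (vert a).2)).
  by apply: eq_bigr => a _; rewrite pE !mulrDr.
rewrite !big_split/= -mulr_suml l1 mul1r; congr (_ + _ + _).
  by rewrite mulr_sumr; apply: eq_bigr => i _; rewrite mulrCA.
by rewrite mulr_sumr; apply: eq_bigr => i _; rewrite mulrCA.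
Qed.

Lemma hull_spans K a b c : spans K a b c ->
  hull K = closed_triangle (vert a) (vert b) (vert c).
Proof.
move=> sK; have [ab bc ac] := spans_neq sK.
have oK := sK.2.
apply/seteqP; split => x.
  move=> Kx.
  have bary_ge0 a' b' c' : spans K a' b' c' ->
      0 <= bary (vert a') (vert b') (vert c') x.
    move=> sK'; have := affine_hull (affine_bary (vert a') (vert b') (vert c')) Kx.
    move=> [l [l0 l1 ->]]; rewrite (sum_spans _ sK').
    have [-> -> ->] := bary_vertices sK'.2.
    by rewrite !mulr0 !addr0 mulr1.
  by split; apply: bary_ge0; [|apply: spans_rot|apply: spans_rot; apply: spans_rot].
move=> [a0 b0 c0].
exists (fun i => if i == a then bary (vert a) (vert b) (vert c) x
  else if i == b then bary (vert b) (vert c) (vert a) x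
  else if i == c then bary (vert c) (vert a) (vert b) x else 0).
  split; first by move=> i; do 3 case: ifP => // _.
  rewrite (sum_spans _ sK) !eqxx [b == a]eq_sym (negbTE ab) [c == a]eq_sym.
  by rewrite (negbTE ac) [c == b]eq_sym (negbTE bc) bary_sum.
rewrite !(sum_spans _ sK) !eqxx [b == a]eq_sym (negbTE ab) [c == a]eq_sym.
rewrite (negbTE ac) [c == b]eq_sym (negbTE bc).
rewrite [LHS]surjective_pairing (affine_barycentric oK x affine_fst).
by rewrite (affine_barycentric oK x affine_snd); congr pair; ring.
Qed.

(** The positivity conditions define an open set inside the closed triangle; a
    point where a coordinate vanishes leaves the triangle when moved away from
    the corresponding vertex. *)
Lemma cell_spans K a b c : spans K a b c ->
  cell K = open_triangle (vert a) (vert b) (vert c).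
Proof.
move=> sK; rewrite /cell (hull_spans sK); apply/seteqP; split => x; last first.
  move=> Tx; apply: filterS (@open_triangle_sub _ _ _ _) _.
  by apply: open_nbhs_nbhs; split => //; exact: open_open_triangle.
move=> Tx.
have pos (A B C : plane R) : orient A B C != 0 ->
    nbhs x [set y | 0 <= bary A B C y] -> 0 < bary A B C x.
  move=> ABC nx; have x0 : 0 <= bary A B C x := nbhs_singleton nx.
  rewrite lt_def x0 andbT; apply/eqP => bx.
  have /= := near_along (x - A) nx => ne.
  near (0 : R)^'+ => e.
  have e0 : 0 < e by near: e; exact: nbhs_right_gt.
  have : 0 <= bary A B C (along x e (x - A)) by near: e.
  rewrite affine_along; last exact: affine_bary.
  have [a0 [a1 [a2 E]]] := affine_bary A B C.
  have [bA _ _] := bary_vertices ABC.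
  have -> : bary A B C (x - A) - bary A B C 0 = bary A B C x - bary A B C A.
    by rewrite !E /=; ring.
  by rewrite bx bA add0r sub0r mulrN1 oppr_ge0 leNgt e0.
split; apply: pos; do ?[exact: sK.2 | exact: (spans_rot sK).2 |
   exact: (spans_rot (spans_rot sK)).2];
  by apply: filterS Tx => y [].
Unshelve. all: by end_near.
Qed.

Section mesh_hyp.
Variable (Omega : set (plane R)).
Hypothesis hM : triangulation M Omega.

Lemma spans_vertex K a : K \in tri M -> a \in K -> exists b c, spans K a b c.
Proof.
move=> tK aK; have [_ /(_ _ tK)[K3 nd] _ _] := hM.
have : #|K :\ a| == 2%N by rewrite -eqSS -K3 (cardsD1 a K) aK.
move=> /cards2P[b [c [bc Kbc]]].
have KE : K = [set a; b; c]%SET.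
  by rewrite -(finset.setD1K aK) Kbc finset.setUA.
have bK : b \in (K :\ a)%SET by rewrite Kbc !inE eqxx.
have cK : c \in (K :\ a)%SET by rewrite Kbc !inE eqxx orbT.
move: bK cK; rewrite !inE => /andP[ba bK] /andP[ca cK].
exists b, c; split => //; rewrite /orient; apply: nd => //=.
by rewrite !inE negb_or eq_sym ba eq_sym ca bc.
Qed.

Lemma spans_tri K : K \in tri M -> exists a b c, spans K a b c.
Proof.
move=> tK; have [_ /(_ _ tK)[K3 nd] _ _] := hM.
have [a aK] : exists a, a \in K by apply/set0Pn; rewrite -card_gt0 K3.
by have [b [c s]] := spans_vertex tK aK; exists a, b, c.
Qed.

Lemma spans_edge K F : K \in tri M -> edge_of F K ->
  exists c, spans K F.1 F.2 c.
Proof.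
move=> tK /and3P[F12 F1 F2]; have [b [c s]] := spans_vertex tK F1.
have := F2; rewrite {1}s.1 !inE => /orP[/orP[/eqP e|/eqP e]|/eqP e].
- by rewrite e ltnn in F12.
- by exists c; rewrite e.
- by exists b; rewrite e; apply: spans_swap; apply: spans_rot; apply: spans_rot.
Qed.

(** Two triangles meet in the hull of their common vertices only.  One of them
    has a vertex outside the other, and the coordinate of that vertex vanishes
    on this hull, whereas it is positive in the open triangle. *)
Lemma cell_disjoint K K' x : K \in tri M -> K' \in tri M ->
  cell K x -> cell K' x -> K = K'.
Proof.
move=> tK tK' Kx K'x; apply/eqP/negPn/negP => KK'.
have [_ c3 _ hI] := hM.
have : ~~ (K \subset K').
  apply: contra KK' => sub; rewrite eqEcard sub.
  by rewrite (c3 _ tK).1 (c3 _ tK').1.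
move=> /subsetPn[a aK aK'].
have [b [c s]] := spans_vertex tK aK.
have Hx : hull (K :&: K') x.
  by rewrite -hI//; split; exact: interior_subset.
have := affine_hull (affine_bary (vert a) (vert b) (vert c)) Hx.
move=> [l [l0 _ lx]].
move: Kx; rewrite (cell_spans s) => -[+ _ _]; rewrite lx.
rewrite big1 ?ltxx// => i; rewrite inE => /andP[iK iK'].
have [_ b0 c0] := bary_vertices s.2.
move: iK; rewrite s.1 !inE => /orP[/orP[/eqP ia|/eqP ->]|/eqP ->].
- by rewrite -ia iK' in aK'.
- by rewrite b0 mulr0.
- by rewrite c0 mulr0.
Qed.

End mesh_hyp.
End triangulation_geometry.

(** * Sides of an edge *)
Section edges.
Context {R : realType} (M : mesh R).
Implicit Types (K : {set 'I_(nvert M)}) (F : 'I_(nvert M) * 'I_(nvert M)).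
Implicit Types (a b c : 'I_(nvert M)) (x d n : plane R) (p : plane R -> R).

(** The edges of [K] are its increasing pairs of vertices; symmetry of [g] makes
    the order of [a], [b] and [c] irrelevant. *)
Lemma sum_edges K a b c (g : 'I_(nvert M) -> 'I_(nvert M) -> R) :
  spans K a b c -> (forall i j, g i j = g j i) ->
  \sum_(F | edge_of F K) g F.1 F.2 = g a b + g b c + g c a.
Proof.
move=> sK gC; have [ab bc ac] := spans_neq sK.
transitivity (\sum_(i in K) \sum_(j in K) if (i < j)%N then g i j else 0).
  transitivity (\sum_(i in K) \sum_(j in K | (i < j)%N) g i j).
    rewrite pair_big_dep /=; apply: eq_bigl => -[i j].
    by rewrite /edge_of /= andbC -andbA.
  by apply: eq_bigr => i _; rewrite big_mkcondr.
rewrite (sum_spans _ sK) !(sum_spans _ sK).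
rewrite !ltnn (gC b a) (gC c b) (gC a c).
move: ab bc ac; rewrite -!val_eqE /=.
by case: (ltngtP a b) => // _ _; case: (ltngtP b c) => // _ _;
  case: (ltngtP a c) => // _ _; ring.
Qed.

Lemma affine_mid p F : affine p ->
  p (edge_mid F) = (p (vert F.1) + p (vert F.2)) / 2.
Proof. by move=> ap; rewrite /edge_mid /edge_vec affine_segment//; field. Qed.

Lemma enorm_sqr x : enorm x ^+ 2 = dot x x.
Proof. by rewrite /enorm sqr_sqrtr// /dot -!expr2 addr_ge0 ?sqr_ge0. Qed.

Lemma edge_vec_neq0 K F c : spans K F.1 F.2 c -> 0 < dot (edge_vec F) (edge_vec F).
Proof.
move=> sK; rewrite /dot -!expr2 lt_def addr_ge0 ?sqr_ge0// andbT.
apply: contra sK.2; rewrite paddr_eq0 ?sqr_ge0// !sqrf_eq0 /edge_vec /=.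
by rewrite /orient => /andP[/eqP -> /eqP ->]; rewrite !mul0r subrr.
Qed.

Definition edge_point F (s : R) : plane R := along (vert F.1) s (edge_vec F).

(** Stated with the third vertex of [K] rather than with [outward_normal], so as
    to apply equally to the unit normal fixed on the edge. *)
Definition points_into K F d : Prop := dot d (edge_vec F) = 0 /\
  exists2 c, spans K F.1 F.2 c & 0 < dot d (vert c - vert F.1).

(** At an interior point of the edge the coordinates of its endpoints are
    positive, and stay so nearby; the coordinate of the third vertex vanishes
    there and increases along [d]. *)
Lemma near_cell K F (s : R) d : 0 < s < 1 -> points_into K F d ->
  \forall e \near 0^'+, cell K (along (edge_point F s) e d).
Proof.
move=> /andP[s0 s1] [de [c sK dc]].
set A := vert F.1 in dc *; set B := vert F.2; set C := vert c in dc *.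
have oABC : orient A B C != 0 := sK.2.
have oBCA : orient B C A != 0 := (spans_rot sK).2.
have oCAB : orient C A B != 0 := (spans_rot (spans_rot sK)).2.
have [aA aB aC] := bary_vertices oABC.
have [bB bC bA] := bary_vertices oBCA.
have [cC cA cB] := bary_vertices oCAB.
have nearpos p : affine p -> 0 < p (edge_point F s) ->
    \forall e \near 0^'+, 0 < p (along (edge_point F s) e d).
  move=> ap p0; apply: (@near_along _ [set x | 0 < p x]).
  by apply: open_nbhs_nbhs; split => //; exact: open_affine_gt0.
have ha : \forall e \near 0^'+, 0 < bary A B C (along (edge_point F s) e d).
  apply: nearpos; first exact: affine_bary.
  rewrite /edge_point affine_segment; last exact: affine_bary.
  by rewrite aA aB mulr1 mulr0 addr0 subr_gt0.
have hb : \forall e \near 0^'+, 0 < bary B C A (along (edge_point F s) e d).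
  apply: nearpos; first exact: affine_bary.
  rewrite /edge_point affine_segment; last exact: affine_bary.
  by rewrite bA bB mulr1 mulr0 add0r.
rewrite (cell_spans sK); near=> e; split; [by near: e|by near: e|].
have e0 : 0 < e by near: e; exact: nbhs_right_gt.
rewrite affine_along; last exact: affine_bary.
rewrite /edge_point affine_segment; last exact: affine_bary.
rewrite -/A -/B cA cB !mulr0 !add0r mulr_gt0//.
rewrite /bary -mulrBl.
(* the cross products of the edge with d and with C - A have the same sign,
   since d is orthogonal to the edge *)
have -> : orient d A B - orient 0 A B =
    dot d (C - A) * dot (B - A) (B - A) / orient C A B.
  apply: (mulIf oCAB); rewrite divfK//.
  transitivity (dot d (C - A) * dot (B - A) (B - A) -
    dot (B - A) (C - A) * dot d (edge_vec F)); last by rewrite de mulr0 subr0.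
  by rewrite /dot /orient /edge_vec /= -/A -/B; ring.
rewrite -/C -[X in 0 < X]mulrA -invfM; apply: divr_gt0.
  exact: mulr_gt0 dc (edge_vec_neq0 sK).
by rewrite -expr2 lt_def sqrf_eq0 oCAB sqr_ge0.
Unshelve. all: by end_near.
Qed.

Section mesh_hyp.
Variable (Omega : set (plane R)).
Hypothesis hM : triangulation M Omega.

Lemma outward_normalP K F : K \in tri M -> edge_of F K ->
  unit_normal F (outward_normal K F) /\ points_into K F (- outward_normal K F).
Proof.
move=> tK eF; have [c sK] := spans_edge hM tK eF.
have e0 := edge_vec_neq0 sK.
have ne0 : enorm (edge_vec F) != 0.
  by rewrite -sqrf_eq0 enorm_sqr gt_eqF.
rewrite /outward_normal; set e := edge_vec F in e0 ne0 *.
set nu : plane R := (_, _).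
have nu1 : dot nu nu = 1.
  rewrite /dot /= -!expr2 !expr_div_n -mulrDl sqrrN enorm_sqr.
  by rewrite addrC [X in X / _](_ : _ = dot e e) ?divff ?gt_eqF// /dot -!expr2.
have nue : dot nu e = 0 by rewrite /dot /=; ring.
have nuc : dot nu (vert c - vert F.1) =
    - orient (vert F.1) (vert F.2) (vert c) / enorm e.
  by rewrite /dot /orient /= /e /edge_vec /=; ring.
have dotN (u v : plane R) : dot (- u) v = - dot u v by rewrite /dot /=; ring.
have dotNN (u : plane R) : dot (- u) (- u) = dot u u by rewrite /dot /=; ring.
have nuc0 : dot nu (vert c - vert F.1) != 0.
  by rewrite nuc mulf_neq0 ?invr_neq0// oppr_eq0; exact: sK.2.
case: ifPn => [/forall_inP H|].
  have cK : c \in K by rewrite sK.1 !inE eqxx orbT.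
  split; first by split.
  split; first by rewrite dotN nue oppr0.
  by exists c => //; rewrite dotN oppr_gt0 lt_def eq_sym nuc0 H.
move=> H; split; first by split; rewrite ?dotNN// dotN nue oppr0.
rewrite opprK; split => //; exists c => //; rewrite ltNge; apply: contra H => H.
apply/forall_inP => i; rewrite {1}sK.1 !inE => /orP[/orP[/eqP ->|/eqP ->]|/eqP -> //].
  by rewrite /dot /= !subrr !mulr0 addr0.
by rewrite -/(edge_vec F) nue.
Qed.

(** Two unit vectors orthogonal to the same nonzero vector are parallel, and
    their inner product is 1 or -1. *)
Lemma unit_normal_unique K F n n' : K \in tri M -> edge_of F K ->
  unit_normal F n -> unit_normal F n' -> n = n' \/ n = - n'.
Proof.
move=> tK eF [n1 ne] [n1' ne']; have [c sK] := spans_edge hM tK eF.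
have e0 := edge_vec_neq0 sK; set e := edge_vec F in ne ne' e0.
have cross : n.1 * n'.2 - n.2 * n'.1 = 0.
  apply: (mulIf (lt0r_neq0 e0)); rewrite mul0r.
  move: ne ne'; rewrite /dot => h h'.
  have -> : (n.1 * n'.2 - n.2 * n'.1) * (e.1 * e.1 + e.2 * e.2) =
    (n.1 * e.1 + n.2 * e.2) * (n'.2 * e.1 - n'.1 * e.2) -
    (n'.1 * e.1 + n'.2 * e.2) * (n.2 * e.1 - n.1 * e.2) by ring.
  by rewrite h h' !mul0r subrr.
have sq : dot n n' ^+ 2 = 1.
  have -> : dot n n' ^+ 2 = dot n n * dot n' n' - (n.1 * n'.2 - n.2 * n'.1) ^+ 2.
    by rewrite /dot; ring.
  by rewrite n1 n1' cross expr0n/= subr0 mulr1.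
have eq0 (u : plane R) : dot u u = 0 -> u = 0.
  case: u => u v; rewrite /dot /= -!expr2 => /eqP.
  by rewrite paddr_eq0 ?sqr_ge0// !sqrf_eq0 => /andP[/eqP -> /eqP ->].
move: sq => /eqP; rewrite -subr_eq0 subr_sqr_1 mulf_eq0 => /orP[] /eqP h.
  left; apply/subr0_eq/eq0.
  have -> : dot (n - n') (n - n') = dot n n + dot n' n' - 2 * dot n n'.
    by rewrite /dot /=; ring.
  by move/subr0_eq: h => ->; rewrite n1 n1'; ring.
right; apply/eqP; rewrite -addr_eq0; apply/eqP/eq0.
have -> : dot (n + n') (n + n') = dot n n + dot n' n' + 2 * dot n n'.
  by rewrite /dot /=; ring.
by move/eqP: h; rewrite addr_eq0 => /eqP ->; rewrite n1 n1'; ring.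
Qed.

(** If both triangles were on the same side of their common edge, short normal
    displacements of its midpoint would lie in both open triangles. *)
Lemma interior_edge_sides F n : F \in interior_edges M -> unit_normal F n ->
  exists K K', [/\ K \in tri M, K' \in tri M, edge_of F K, edge_of F K' &
    n = - outward_normal K F /\ - n = - outward_normal K' F].
Proof.
rewrite inE => /exists_inP[K tK /exists_inP[K' tK' /and3P[KK' eF eF']]] nF.
have [u1 oi] := outward_normalP tK eF.
have [u2 oi'] := outward_normalP tK' eF'.
have half : 0 < (2^-1 : R) < 1 by apply/andP; split; lra.
have opp : outward_normal K F = - outward_normal K' F.
  have [oo|//] := unit_normal_unique tK eF u1 u2.
  exfalso; move/eqP: KK'; apply.
  have h := near_cell half oi; rewrite oo in h.
  have h' := near_cell half oi'.
  near (0 : R)^'+ => e.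
  by apply: (cell_disjoint hM tK tK' (x := along (edge_point F 2^-1) e
    (- outward_normal K' F))); near: e.
have [->|->] := unit_normal_unique tK eF nF u1.
  by exists K', K; split => //; rewrite opp opprK.
by exists K, K'; split => //; rewrite opp !opprK.
Unshelve. all: by end_near.
Qed.

End mesh_hyp.
End edges.

(** * Finite sums and unions *)
Section integration_lemmas.
Context d (T : measurableType d) (R : realType).
Variable (mu : {measure set T -> \bar R}).

Lemma Rintegral_sum (D : set T) (I : Type) (r : seq I) (P : pred I)
    (F : I -> T -> R) : measurable D ->
  (forall i, P i -> mu.-integrable D (EFin \o F i)) ->
  \int[mu]_(x in D) (\sum_(i <- r | P i) F i x) =
  \sum_(i <- r | P i) \int[mu]_(x in D) F i x.
Proof.
move=> mD iF; elim: r => [|i r IH].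
  rewrite big_nil; under eq_Rintegral do rewrite big_nil.
  by rewrite Rintegral_cst// mul0r.
rewrite big_cons; under eq_Rintegral do rewrite big_cons.
case: ifP => // Pi; rewrite RintegralD ?IH//; first exact: iF.
have := integrable_sum mD r iF; apply: eq_integrable => // x _ /=.
by rewrite sumEFin.
Qed.

Lemma measure_big_disjoint (I : eqType) (s : seq I) (F : I -> set T) :
  (forall i, measurable (F i)) -> uniq s -> trivIset [set` s] F ->
  mu (\big[setU/set0]_(i <- s) F i) = (\sum_(i <- s) mu (F i))%E.
Proof.
move=> mF us tF; have mU : measurable (\big[setU/set0]_(i <- s) F i).
  exact: bigsetU_measurable.
rewrite -[LHS]mul1e -integral_cst//.
rewrite (ge0_integral_bigsetU mu mF us tF)//.
by apply: eq_bigr => i _; rewrite integral_cst// mul1e.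
Qed.

Lemma measure_big_le (I : Type) (s : seq I) (F : I -> set T) :
  (forall i, measurable (F i)) ->
  (mu (\big[setU/set0]_(i <- s) F i) <= \sum_(i <- s) mu (F i))%E.
Proof.
move=> mF; elim: s => [|i s IH]; first by rewrite !big_nil measure0.
rewrite !big_cons; apply: (le_trans (measureU2 _ _ _)) => //.
  exact: bigsetU_measurable.
exact: leeD2l.
Qed.

End integration_lemmas.

(** * Piecewise affine functions on a mesh *)
Section cells.
Context {R : realType} (M : mesh R) (Omega : set (plane R)).
Hypothesis hM : triangulation M Omega.
Implicit Types (K : {set 'I_(nvert M)}) (F : 'I_(nvert M) * 'I_(nvert M)).
Implicit Types (x d : plane R) (p v : plane R -> R).

Lemma open_cell K : open (cell K).
Proof. exact: open_interior. Qed.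

Lemma measurable_cell K : measurable (cell K).
Proof. by apply: measurable_open_plane; exact: open_cell. Qed.

Lemma closed_hull K : K \in tri M -> closed (hull K).
Proof.
move=> tK; have [a [b [c s]]] := spans_tri hM tK.
by rewrite (hull_spans s); exact: closed_closed_triangle.
Qed.

Lemma measurable_hull K : K \in tri M -> measurable (hull K).
Proof.
move=> tK; have [a [b [c s]]] := spans_tri hM tK.
by rewrite (hull_spans s); exact: measurable_closed_triangle.
Qed.

Lemma area_hull K : K \in tri M -> area (hull K) = area (cell K).
Proof.
move=> tK; have [a [b [c s]]] := spans_tri hM tK.
by rewrite (hull_spans s) (cell_spans s) area_closed_triangle// s.2.
Qed.

Lemma area_cell_gt0 K : K \in tri M -> (0 < area (cell K))%E.
Proof.
move=> tK; have [a [b [c s]]] := spans_tri hM tK.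
by rewrite (cell_spans s) area_open_triangle_gt0// s.2.
Qed.

Lemma area_cell_lty K : K \in tri M -> (area (cell K) < +oo)%E.
Proof.
move=> tK; have [a [b [c s]]] := spans_tri hM tK.
by rewrite (cell_spans s) area_open_triangle_lty// s.2.
Qed.

Lemma area_cell_neq0 K p (u w : plane R) : K \in tri M -> affine p -> p u != p w ->
  area (cell K `&` [set x | p x != 0]) = area (cell K).
Proof.
move=> tK; have [a [b [c s]]] := spans_tri hM tK.
by rewrite (cell_spans s); apply: area_triangle_neq0; exact: s.2.
Qed.

Lemma bounded_affine_cell K p : K \in tri M -> affine p ->
  exists C, forall x, cell K x -> `|p x| <= C.
Proof.
move=> tK ap; have [a [b [c s]]] := spans_tri hM tK.
exists (`|p (vert a)| + `|p (vert b)| + `|p (vert c)|) => x.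
rewrite (cell_spans s) => /open_triangle_sub Kx.
exact: (affine_triangle_bound s.2 ap Kx).
Qed.

Lemma integrable_affine_cell K p : K \in tri M -> affine p ->
  (@plane_measure R).-integrable (cell K) (EFin \o p).
Proof.
move=> tK ap; have [C pC] := bounded_affine_cell tK ap.
apply: (bounded_integrable (M := C)) => //; first exact: measurable_cell.
  exact: area_cell_lty.
exact: measurable_affine.
Qed.

(** The mean of the three vertex values equals the mean of the three midpoint
    values, as each vertex belongs to two edges. *)
Lemma integral_affine_cell K p : K \in tri M -> affine p ->
  \int[area]_(x in cell K) p x =
  fine (area (cell K)) / 3 * \sum_(F | edge_of F K) p (edge_mid F).
Proof.
move=> tK ap; have [a [b [c s]]] := spans_tri hM tK.
rewrite (cell_spans s) (integral_affine_triangle s.2 ap); congr (_ * _).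
transitivity (\sum_(F | edge_of F K) (p (vert F.1) + p (vert F.2)) / 2).
  rewrite (sum_edges (g := fun i j => (p (vert i) + p (vert j)) / 2) s).
    by field.
  by move=> i j; rewrite addrC.
by apply: eq_bigr => F _; rewrite affine_mid.
Qed.

(** The midpoint values determine the sums of two vertex values, hence the
    vertex values. *)
Lemma affine_eq_midpoints K p (k : R) : K \in tri M -> affine p ->
  (forall F, edge_of F K -> p (edge_mid F) = k) -> forall x, p x = k.
Proof.
move=> tK ap pk x; have [a [b [c s]]] := spans_tri hM tK.
have mid i j : i \in K -> j \in K -> i != j -> p (vert i) + p (vert j) = 2 * k.
  move=> iK jK; have h F : edge_of F K -> p (vert F.1) + p (vert F.2) = 2 * k.
    by move=> /pk; rewrite affine_mid// => <-; field.
  rewrite -val_eqE; case: (ltngtP i j) => // ij _.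
    by apply: (h (i, j)); rewrite /edge_of ij iK jK.
  by rewrite addrC; apply: (h (j, i)); rewrite /edge_of ij iK jK.
have [ab bc ac] := spans_neq s.
have aK : a \in K by rewrite s.1 !inE eqxx.
have bK : b \in K by rewrite s.1 !inE eqxx orbT.
have cK : c \in K by rewrite s.1 !inE eqxx orbT.
have hab := mid _ _ aK bK ab; have hbc := mid _ _ bK cK bc.
have hac := mid _ _ aK cK ac.
rewrite (affine_barycentric s.2 x ap).
have -> : p (vert a) = k by lra.
have -> : p (vert b) = k by lra.
have -> : p (vert c) = k by lra.
by rewrite -!mulrDr (bary_sum s.2) mulr1.
Qed.

(** An open triangle is contained in the interior of the closure of [Omega],
    which is [Omega] since there are no cracks. *)
Lemma cell_sub_domain K : polygonal_domain Omega -> K \in tri M ->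
  cell K `<=` Omega.
Proof.
move=> [_ _ _ _ [<- _]] tK; have [_ _ -> _] := hM.
by apply: interiorS => x Kx; exists K.
Qed.

Lemma integral_piecewise_affine v (g : {set 'I_(nvert M)} -> plane R -> R) :
  polygonal_domain Omega -> (forall K, affine (g K)) ->
  (forall K, K \in tri M -> forall x, cell K x -> v x = g K x) ->
  (forall x, (forall K, K \in tri M -> ~ cell K x) -> v x = 0) ->
  \int[area]_(x in Omega) v x = \sum_(K in tri M) \int[area]_(x in cell K) g K x.
Proof.
move=> hO ag vg v0.
have vE x : (v \_ Omega) x = \sum_(K in tri M) (g K \_ (cell K)) x.
  have [[K [tK Kx]]|noK] := pselect (exists K, K \in tri M /\ cell K x).
    rewrite patchE ifT; last by rewrite inE; exact: cell_sub_domain Kx.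
    rewrite (bigD1 K)//= patchE ifT ?inE// (vg _ tK _ Kx) big1 ?addr0//.
    move=> K' /andP[tK' K'K]; rewrite patchE ifF//; apply/negbTE.
    rewrite notin_setE => K'x; move/eqP: K'K; apply.
    exact: (cell_disjoint hM tK' tK K'x Kx).
  have out K : K \in tri M -> ~ cell K x by move=> tK Kx; apply: noK; exists K.
  rewrite big1; last first.
    by move=> K tK; rewrite patchE ifF//; apply/negbTE; rewrite notin_setE; exact: out.
  by rewrite patchE v0//; case: ifP.
rewrite Rintegral_mkcond; under eq_Rintegral do rewrite vE.
rewrite Rintegral_sum//; last first.
  move=> K tK; have := integrable_affine_cell tK (ag K).
  have mK : @measurable _ (measurableTypeR R * measurableTypeR R)%type (cell K).
    exact: measurable_cell.
  rewrite (integrable_mkcond _ mK).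
  by rewrite restrict_EFin.
by apply: eq_bigr => K tK; rewrite -Rintegral_mkcond.
Qed.

Lemma side_lim_affine v p x d : affine p ->
  (\forall e \near 0^'+, v (along x e d) = p (along x e d)) ->
  side_lim v x d = p x.
Proof.
move=> ap nv; apply: cvg_lim => //.
have cp : p (along x e d) @[e --> 0^'+] --> p x.
  apply: (@cvg_comp _ _ _ (fun e => along x e d) p _ (nbhs x)).
    exact: (cvg_at_right_filter (@cvg_along _ x d)).
  exact: (@continuous_affine _ p ap x).
apply: cvg_trans cp; apply: near_eq_cvg.
by apply: filterS nv => e ->.
Qed.

Lemma side_lim_cell K F v p (s : R) n : K \in tri M -> affine p ->
  (forall x, cell K x -> v x = p x) -> points_into K F n -> 0 < s < 1 ->
  side_lim v (edge_point F s) n = p (edge_point F s).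
Proof.
move=> tK ap vp nK s01; apply: side_lim_affine => //.
by apply: filterS (near_cell s01 nK) => e; exact: vp.
Qed.

Lemma trace_cell K F v p (s : R) : K \in tri M -> affine p ->
  (forall x, cell K x -> v x = p x) -> edge_of F K -> 0 < s < 1 ->
  trace K F v (edge_point F s) = p (edge_point F s).
Proof.
move=> tK ap vp eF s01; apply: (side_lim_cell tK) => //.
exact: (outward_normalP hM tK eF).2.
Qed.

(** [v] and [p] agree on a neighbourhood of [x], so they have the same partial
    derivatives there. *)
Lemma grad_cell K v p x : affine p ->
  (forall x, cell K x -> v x = p x) -> cell K x -> grad v x = grad p 0.
Proof.
move=> ap vp Kx; rewrite -(grad_affine x ap) /grad /dx /dy !derive1E.
have nK : nbhs x (cell K) by apply: open_nbhs_nbhs; split => //; exact: open_cell.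
have c1 : (s, x.2) @[s --> x.1] --> x.
  by case: x {Kx nK} => x1 x2; exact: (cvg_pair cvg_id (cvg_cst _)).
have c2 : (x.1, s) @[s --> x.2] --> x.
  by case: x {Kx nK c1} => x1 x2; exact: (cvg_pair (cvg_cst _) cvg_id).
congr pair; apply: near_eq_derive.
  have : \forall s \near x.1, cell K (s, x.2) := c1 _ nK.
  by apply: filterS => s; exact: vp.
have : \forall s \near x.2, cell K (x.1, s) := c2 _ nK.
by apply: filterS => s; exact: vp.
Qed.

End cells.

(** * The Crouzeix-Raviart basis and the lumped masses *)
Section basis.
Context {R : realType} (M : mesh R) (Omega : set (plane R)).
Hypotheses (hOmega : polygonal_domain Omega) (hM : triangulation M Omega).
Variables (nrm : 'I_(nvert M) * 'I_(nvert M) -> plane R).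
Variables (phi : 'I_(nedges M) -> plane R -> R).
Hypothesis hphi : cr_basis nrm phi.
Implicit Types (K : {set 'I_(nvert M)}) (F : 'I_(nvert M) * 'I_(nvert M)).

(** The affine functions that represent the basis on each triangle.  Unlike the
    basis functions they are defined up to the edges, where they give the
    traces. *)
Definition pieces
    (q : 'I_(nedges M) -> {set 'I_(nvert M)} -> plane R -> R) : Prop :=
  (forall i K, affine (q i K)) /\
  (forall i K, K \in tri M -> forall x, cell K x -> phi i x = q i K x).

Lemma pieces_exist : exists q, pieces q.
Proof.
have ex (iK : 'I_(nedges M) * {set 'I_(nvert M)}) : exists p, affine p /\
    (iK.2 \in tri M -> forall x, cell iK.2 x -> phi iK.1 x = p x).
  have [[[pw _] _] _] := hphi iK.1.
  have [tK|ntK] := boolP (iK.2 \in tri M); last first.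
    by exists (fun=> 0); split => //; exact: affine_cst.
  by have [p ap pE] := pw _ tK; exists p.
have [q qP] := choice ex.
by exists (fun i K => q (i, K)); split => [i K|i K tK]; have [? h] := qP (i, K);
  [|exact: h].
Qed.

Lemma basis_eq0_off_cells i x : (forall K, K \in tri M -> ~ cell K x) -> phi i x = 0.
Proof. by have [[[_ out] _] _] := hphi i; exact: out. Qed.

Lemma edge_of_edges K F : K \in tri M -> edge_of F K ->
  exists j : 'I_(nedges M), edge j = F.
Proof.
move=> tK eF; have FE : F \in edges M by rewrite inE; apply/exists_inP; exists K.
by exists (enum_rank_in FE F); rewrite /edge enum_rankK_in.
Qed.

Variable q : 'I_(nedges M) -> {set 'I_(nvert M)} -> plane R -> R.
Hypothesis qP : pieces q.

Lemma piece_mid i K F : K \in tri M -> edge_of F K ->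
  q i K (edge_mid F) = (edge i == F)%:R.
Proof.
move=> tK eF; have [j jF] := edge_of_edges tK eF; have [aq qE] := qP.
have [_ /(_ j K tK)] := hphi i; rewrite jF => /(_ eF) h.
have half : 0 < (2^-1 : R) < 1 by apply/andP; split; lra.
rewrite -jF (inj_eq enum_val_inj) -h.
by rewrite jF (trace_cell hM tK (aq i K) (qE i K tK) eF half).
Qed.

Lemma sum_piece_mid i K : K \in tri M ->
  \sum_(F | edge_of F K) q i K (edge_mid F) = (edge_of (edge i) K)%:R.
Proof.
move=> tK; transitivity (\sum_(F | edge_of F K) (edge i == F)%:R : R).
  by apply: eq_bigr => F eF; exact: piece_mid.
have [eK|neK] := boolP (edge_of (edge i) K).
  rewrite (bigD1 (edge i))//= eqxx big1 ?addr0// => F /andP[_ Fi].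
  by rewrite eq_sym (negbTE Fi).
rewrite big1// => F eF; case: eqP => // iF.
by rewrite iF eF in neK.
Qed.

(** Partition of unity: at the midpoint of an edge of [K] exactly one basis
    function is 1 and the others vanish. *)
Lemma sum_pieces K x : K \in tri M -> \sum_i q i K x = 1.
Proof.
move=> tK; have [aq _] := qP.
apply: (affine_eq_midpoints hM (p := fun x => \sum_i q i K x) tK).
  by apply: affine_sum => i _.
move=> F eF; have [j jF] := edge_of_edges tK eF.
rewrite (bigD1 j)//= piece_mid// jF eqxx big1 ?addr0// => i ij.
by rewrite piece_mid// -jF (inj_eq enum_val_inj) (negbTE ij).
Qed.

Lemma piece_eq0 i K x : K \in tri M -> ~~ edge_of (edge i) K -> q i K x = 0.
Proof.
move=> tK neK; have [aq _] := qP.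
apply: (affine_eq_midpoints hM tK (aq i K)) => F eF.
by rewrite piece_mid//; case: eqP => // iF; rewrite iF eF in neK.
Qed.

Definition mass i : R :=
  (\sum_(K in tri M | edge_of (edge i) K) fine (area (cell K))) / 3.

Lemma edge_tri i : exists K, (K \in tri M) && edge_of (edge i) K.
Proof.
have := enum_valP i; rewrite inE => /exists_inP[K tK eK].
by exists K; rewrite tK.
Qed.

Lemma mass_gt0 i : 0 < mass i.
Proof.
have [K /andP[tK eK]] := edge_tri i.
have pos K' : K' \in tri M -> 0 < fine (area (cell K')).
  by move=> tK'; rewrite fine_gt0// (area_cell_gt0 hM tK') (area_cell_lty hM tK').
rewrite divr_gt0// (bigD1 K) ?tK//= ltr_wpDr ?pos//.
by apply: sumr_ge0 => K' /andP[/andP[tK' _] _]; exact/ltW/pos.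
Qed.

(** On [K] the quadrature formula sums the midpoint values of the discrete
    function, that is, the coefficients [U i 0] of the edges of [K]. *)
Lemma integral_discrete_fun (U : 'cV[R]_(nedges M)) :
  \int[area]_(x in Omega) discrete_fun phi U x = \sum_i mass i * U i 0.
Proof.
have [aq qE] := qP.
pose g K x := \sum_i U i 0 * q i K x.
have ag K : affine (g K) by apply: affine_sum => i _; exact: affineZ.
rewrite (integral_piecewise_affine hM hOmega ag); last 2 first.
- by move=> K tK x Kx; apply: eq_bigr => i _; rewrite (qE i K tK x Kx).
- move=> x out; rewrite /discrete_fun big1// => i _.
  by rewrite basis_eq0_off_cells ?mulr0.
transitivity (\sum_(K in tri M) \sum_(i | edge_of (edge i) K)
    fine (area (cell K)) / 3 * U i 0).
  apply: eq_bigr => K tK; rewrite (integral_affine_cell hM)// -mulr_sumr; congr (_ * _).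
  rewrite exchange_big /= [RHS]big_mkcond /=; apply: eq_bigr => i _.
  by rewrite -mulr_sumr sum_piece_mid//; case: ifP; rewrite ?mulr1 ?mulr0.
rewrite (exchange_big_dep xpredT)//=; apply: eq_bigr => i _.
by rewrite /mass mulr_suml mulr_suml.
Qed.

Lemma supp_basis_sub i : supp (phi i) `<=`
  \big[setU/set0]_(K <- enum [pred K | (K \in tri M) && edge_of (edge i) K]) hull K.
Proof.
have [aq qE] := qP.
set H := \big[_/_]_(K <- _) _.
have cH : closed H.
  apply: closed_bigsetU => K; rewrite mem_enum => /andP[tK _].
  exact: (closed_hull hM tK).
rewrite ((closure_id H).1 cH); apply: closureS => x /= phix; rewrite /H.
have [[K [tK Kx]]|noK] := pselect (exists K, K \in tri M /\ cell K x); last first.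
  by move/eqP: phix; case; apply: basis_eq0_off_cells => K tK Kx; apply: noK;
    exists K.
rewrite -bigcup_seq; exists K; last exact: interior_subset.
rewrite /= mem_enum inE tK /=; apply: contraNT phix => neK.
by rewrite (qE i K tK x Kx) piece_eq0.
Qed.

Lemma supp_basis_sup i :
  \big[setU/set0]_(K <- enum [pred K | (K \in tri M) && edge_of (edge i) K])
    (cell K `&` [set x | q i K x != 0]) `<=` supp (phi i).
Proof.
have [aq qE] := qP.
rewrite -bigcup_seq => x [K]; rewrite /= mem_enum => /andP[tK _] [Kx qx].
by apply: subset_closure; rewrite /= (qE i K tK x Kx).
Qed.

(** The support lies between the closed triangles having the [i]-th edge and the
    part of the open ones where the affine piece is nonzero; the two bounds
    differ by finitely many segments of lines, a null set. *)
Lemma area_supp i : fine (area (supp (phi i))) / 3 = mass i.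
Proof.
have [aq qE] := qP.
have mS : measurable (supp (phi i)).
  rewrite -[supp _]setCK; apply: measurableC; apply: measurable_open_plane.
  by apply: closed_openC; exact: closed_closure.
set s := enum [pred K | (K \in tri M) && edge_of (edge i) K].
have sP K : K \in s -> (K \in tri M) && edge_of (edge i) K by rewrite mem_enum.
pose H K := if K \in tri M then hull K else set0.
pose G K := if K \in tri M then cell K `&` [set x | q i K x != 0] else set0.
have mH K : measurable (H K).
  by rewrite /H; case: ifP => [tK|_]; [exact: (measurable_hull hM tK)|exact: measurable0].
have mG K : measurable (G K).
  rewrite /G; case: ifP => [tK|_]; last exact: measurable0.
  apply: measurableI; first exact: measurable_cell.
  rewrite -[X in measurable X]setCK; apply: measurableC.
  rewrite (_ : ~` _ = [set x | q i K x = 0]);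
    first exact: measurable_affine_eq0.
  by apply/seteqP; split => x /=; [move=> /negP/negPn/eqP|move=> -> /eqP].
have aG K : K \in s -> area (G K) = area (cell K).
  move=> /sP/andP[tK eK]; rewrite /G tK.
  (* the piece is 1 at the midpoint of its own edge and 0 at that of another
     edge of K, hence is not constant *)
  have [F [eF neF]] : exists F, edge_of F K /\ edge i != F.
    have [c sK] := spans_edge hM tK eK; have [_ bc ac] := spans_neq sK.
    have aK : (edge i).1 \in K by rewrite sK.1 !inE eqxx.
    have cK : c \in K by rewrite sK.1 !inE eqxx !orbT.
    move: (ac); rewrite -val_eqE; case: (ltngtP (edge i).1 c) => // lac _.
      exists ((edge i).1, c); split; first by rewrite /edge_of lac aK cK.
      by apply: contra bc => /eqP ->.
    exists (c, (edge i).1); split; first by rewrite /edge_of lac aK cK.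
    by apply: contra ac => /eqP {1}->.
  apply: (area_cell_neq0 hM (u := edge_mid (edge i)) (w := edge_mid F)) => //.
  by rewrite !piece_mid// eqxx (negbTE neF) oner_neq0.
have aH K : K \in s -> area (H K) = area (cell K).
  by move=> /sP/andP[tK eK]; rewrite /H tK (area_hull hM).
suff -> : area (supp (phi i)) = (\sum_(K <- s) area (cell K))%E.
  rewrite /mass; congr (_ / _).
  rewrite (eq_big_seq (fun K => (fine (area (cell K)))%:E)).
    by rewrite sumEFin /= big_enum.
  move=> K /sP/andP[tK _]; rewrite fineK// ge0_fin_numE//; exact: (area_cell_lty hM tK).
apply/eqP; rewrite eq_le; apply/andP; split.
  have <- : (\sum_(K <- s) area (H K) = \sum_(K <- s) area (cell K))%E.
    exact: eq_big_seq.
  apply: (le_trans _ (measure_big_le (plane_measure R) s mH)).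
  apply: le_area => //; first exact: bigsetU_measurable.
  rewrite (eq_big_seq (fun K => hull K)) => [|K /sP/andP[tK _]]; last by rewrite /H tK.
  exact: supp_basis_sub.
have <- : (\sum_(K <- s) area (G K) = \sum_(K <- s) area (cell K))%E.
  exact: eq_big_seq.
have tG : trivIset [set` s] G.
  apply/trivIsetP => K K' _ _ KK'; apply/seteqP; split => // x [].
  rewrite /G; case: ifP => // tK [Kx _]; case: ifP => // tK' [K'x _].
  by move/eqP: KK'; apply; exact: (cell_disjoint hM tK tK' Kx K'x).
apply: (@le_trans _ _ (area (\big[setU/set0]_(K <- s) G K))).
  by rewrite [leRHS](measure_big_disjoint (plane_measure R) mG (enum_uniq _) tG).
apply: le_area => //; first exact: bigsetU_measurable.
rewrite (eq_big_seq (fun K => cell K `&` [set x | q i K x != 0]))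
  => [|K /sP/andP[tK _]]; last by rewrite /G tK.
exact: supp_basis_sup.
Qed.

Lemma lumped_massE : lumped_mass phi = diag_mx (\row_i mass i).
Proof. by congr diag_mx; apply/rowP => i; rewrite !mxE area_supp. Qed.

End basis.

(** * Column sums of the stiffness matrix *)
Lemma integrable_mul_bounded d (T : measurableType d) (R : realType)
    (mu : {measure set T -> \bar R}) (D : set T) (g h : T -> R) (C : R) :
  measurable D -> measurable_fun D h -> (forall x, D x -> `|h x| <= C) ->
  mu.-integrable D (EFin \o g) -> mu.-integrable D (fun x => (g x * h x)%:E).
Proof.
move=> mD mh hC ig.
have := @integrableMr _ _ _ mu D mD h (EFin \o g) mh _ ig.
have bh : [bounded h x | x in D].
  exists C; split; first exact: num_real.
  by move=> y Cy x Dx; apply: (le_trans (hC _ Dx)); exact: ltW.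
move=> /(_ bh); apply: eq_integrable => // x _ /=.
by rewrite -EFinM mulrC.
Qed.

Section column_sums.
Context {R : realType} (M : mesh R) (Omega : set (plane R)).
Hypotheses (hOmega : polygonal_domain Omega) (hM : triangulation M Omega).
Variables (nrm : 'I_(nvert M) * 'I_(nvert M) -> plane R).
Hypothesis hnrm : forall F, F \in edges M -> unit_normal F (nrm F).
Variables (phi : 'I_(nedges M) -> plane R -> R).
Hypothesis hphi : cr_basis nrm phi.
Variable q : 'I_(nedges M) -> {set 'I_(nvert M)} -> plane R -> R.
Hypothesis qP : pieces phi q.
Variable beta : plane R -> plane R.
Hypothesis hbounded : bounded_measurable Omega beta.
Hypothesis htraces : has_normal_traces M beta.
Hypothesis hflux : no_flux M Omega beta.
Implicit Types (K : {set 'I_(nvert M)}) (F : 'I_(nvert M) * 'I_(nvert M)).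

Local Notation mu := (@lebesgue_measure R).

Lemma integrable_flux_cell K (g : plane R) : K \in tri M ->
  (@plane_measure R).-integrable (cell K) (EFin \o (fun x => dot (beta x) g)).
Proof.
move=> tK; have [m1 m2 [C bC]] := hbounded.
have KO := cell_sub_domain hM hOmega tK.
have mO : measurable Omega by apply: measurable_open_plane; case: hOmega.
have norm1 (x : plane R) : `|x.1| <= enorm x.
  by rewrite -sqrtr_sqr ler_wsqrtr// /dot -!expr2 lerDl sqr_ge0.
have norm2 (x : plane R) : `|x.2| <= enorm x.
  by rewrite -sqrtr_sqr ler_wsqrtr// /dot -!expr2 lerDr sqr_ge0.
apply: (bounded_integrable (M := C * `|g.1| + C * `|g.2|)).
- exact: measurable_cell.
- exact: (area_cell_lty hM tK).
- by apply: measurable_funD; apply: measurable_funM => //;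
    [exact: measurable_funS mO KO m1|exact: measurable_funS mO KO m2].
- move=> x /KO Ox; apply: (le_trans (ler_normD _ _)); rewrite !normrM.
  by apply: lerD; apply: ler_wpM2r => //; apply: (le_trans _ (bC _ Ox)).
Qed.

(** Testing with all basis functions is testing with the constant 1. *)
Lemma sum_a_form j : \sum_i a_form M beta (phi j) (phi i) =
  \sum_(K in tri M) \int[area]_(x in cell K) dot (beta x) (grad (q j K) x).
Proof.
have [aq qE] := qP.
transitivity (\sum_i \sum_(K in tri M)
  \int[area]_(x in cell K) (dot (beta x) (grad (phi j) x) * phi i x)).
  by reflexivity.
rewrite exchange_big /=; apply: eq_bigr => K tK.
have gE x : cell K x -> grad (phi j) x = grad (q j K) 0.
  exact: (grad_cell (aq j K) (qE j K tK)).
rewrite -Rintegral_sum; last 2 first.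
- exact: measurable_cell.
- move=> i _; have [C qC] := bounded_affine_cell hM tK (aq i K).
  have := @integrable_mul_bounded _ _ _ area (cell K) _ (q i K) C
    (measurable_cell K) (measurable_affine (aq i K)) qC
    (integrable_flux_cell (grad (q j K) 0) tK).
  apply: eq_integrable; first exact: measurable_cell.
  by move=> x /[!inE] Kx /=; rewrite (gE _ Kx) (qE i K tK x Kx).
apply: eq_Rintegral => x /[!inE] Kx.
rewrite -mulr_sumr (gE _ Kx) (grad_affine x (aq j K)).
rewrite (eq_bigr (fun i => q i K x)) => [|i _]; last exact: (qE i K tK x Kx).
by rewrite (sum_pieces hM hphi qP x tK) mulr1.
Qed.

Lemma measurable_edge_set F (A : set (plane R)) : open A ->
  measurable [set s : measurableTypeR R |
    A (along (vert F.1) s (vert F.2 - vert F.1))].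
Proof.
move=> oA; apply: open_measurable.
apply: (@open_comp _ _ (fun s : R => along (vert F.1) s (vert F.2 - vert F.1)) A) => //.
by move=> s _; exact: continuous_along.
Qed.

Lemma bounded_affine_edge F p : affine p ->
  exists C, forall s, 0 < s < 1 -> `|p (edge_point F s)| <= C.
Proof.
move=> ap; exists (`|p (vert F.1)| + `|p (vert F.2)|) => s /andP[s0 s1].
rewrite /edge_point affine_segment//; apply: (le_trans (ler_normD _ _)).
rewrite !normrM (gtr0_norm s0) gtr0_norm ?subr_gt0//.
by apply: lerD; rewrite ler_piMl//; lra.
Qed.

Lemma measurable_affine_edge F p (D : set (measurableTypeR R)) : affine p ->
  measurable_fun D (fun s => p (edge_point F s)).
Proof.
move=> ap; rewrite (_ : (fun s => p (edge_point F s)) =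
  fun s => (1 - s) * p (vert F.1) + s * p (vert F.2)).
  by apply: measurable_funTS; apply: measurable_funD;
    apply: measurable_funM => //; exact: measurable_funB.
by apply/funext => s; rewrite /edge_point affine_segment.
Qed.

Lemma integrable_affine_edge F p (D : set (measurableTypeR R)) (g : R -> R) :
  measurable D ->
  D `<=` `]0, 1[ -> affine p -> mu.-integrable D (EFin \o g) ->
  mu.-integrable D (fun s => (g s * p (edge_point F s))%:E).
Proof.
move=> mD D01 ap ig; have [C pC] := bounded_affine_edge F ap.
apply: (integrable_mul_bounded (C := C)) => //.
  exact: measurable_affine_edge.
by move=> s /D01; rewrite /= in_itv /=; exact: pC.
Qed.

Lemma sum_edge_traces j K F (A : set (plane R)) : K \in tri M -> edge_of F K ->
  open A ->
  \sum_i edge_int F A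
    (fun x => normal_trace beta K F x * trace K F (phi j) x *
      trace K F (phi i) x) =
  edge_int F A (fun x => normal_trace beta K F x * q j K x).
Proof.
move=> tK eF oA; have [aq qE] := qP.
rewrite /edge_int /line_int -mulr_sumr; congr (_ * _).
set D := _ `&` _.
have D01 : D `<=` `]0, 1[ by exact: subIsetl.
have mD : @measurable _ (measurableTypeR R) D.
  by apply: measurableI => //; exact: measurable_edge_set.
have in01 s : s \in D -> 0 < s < 1.
  by rewrite inE => /D01; rewrite /= in_itv.
have tE i s : s \in D ->
    trace K F (phi i) (along (vert F.1) s (vert F.2 - vert F.1)) =
    q i K (edge_point F s).
  by move=> /in01; exact: (trace_cell hM tK (aq i K) (qE i K tK) eF).
rewrite -Rintegral_sum//; last first.
  move=> i _.
  have itr : mu.-integrable D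
      (EFin \o fun s => normal_trace beta K F (edge_point F s)).
    by apply: (integrableS _ mD D01 (htraces tK eF).2).
  have := integrable_affine_edge F mD D01 (aq i K)
    (integrable_affine_edge F mD D01 (aq j K) itr).
  by apply: eq_integrable => // s sD /=; rewrite !tE.
apply: eq_Rintegral => s sD /=.
rewrite -mulr_sumr; under eq_bigr do rewrite tE//.
by rewrite (sum_pieces hM hphi qP _ tK) mulr1 tE.
Qed.

(** The jump of the sum of all basis functions is 1 - 1 = 0.  Taking the sum
    inside the integral requires the upwind flux to be integrable: on the side
    that the fixed normal points away from, beta . n_F is the normal trace of a
    triangle. *)
Lemma sum_upwind j F : F \in interior_edges M ->
  \sum_i edge_int F setT
    (fun x => upwind beta (nrm F) (phi j) x * - jump (nrm F) (phi i) x) = 0.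
Proof.
move=> iF; have [aq qE] := qP.
have nF : unit_normal F (nrm F).
  apply: hnrm; move: iF; rewrite !inE => /exists_inP[K tK /exists_inP[K' _ /and3P[_ eF _]]].
  by apply/exists_inP; exists K.
have [K [K' [tK tK' eF eF' [nK nK']]]] := interior_edge_sides hM iF nF.
have up s i : 0 < s < 1 ->
    side_lim (phi i) (edge_point F s) (nrm F) = q i K (edge_point F s).
  move=> s01; apply: (side_lim_cell tK (aq i K) (qE i K tK)) => //.
  by rewrite nK; exact: (outward_normalP hM tK eF).2.
have dn s i : 0 < s < 1 ->
    side_lim (phi i) (edge_point F s) (- nrm F) = q i K' (edge_point F s).
  move=> s01; apply: (side_lim_cell tK' (aq i K') (qE i K' tK')) => //.
  by rewrite nK'; exact: (outward_normalP hM tK' eF').2.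
rewrite /edge_int /line_int -mulr_sumr.
set D := _ `&` _.
have D01 : D `<=` `]0, 1[ by exact: subIsetl.
have mD : @measurable _ (measurableTypeR R) D.
  by apply: measurableI => //; apply: measurable_edge_set; exact: openT.
have in01 s : s \in D -> 0 < s < 1.
  by rewrite inE => /D01; rewrite /= in_itv.
pose bn s := normal_trace beta K' F (edge_point F s).
have bnE s : side_lim (vcomp beta (nrm F)) (edge_point F s) (- nrm F) = bn s.
  rewrite /bn /normal_trace /trace -nK'.
  by move: nK' => /oppr_inj <-.
have ibn : mu.-integrable D (EFin \o bn).
  by apply: (integrableS _ mD D01 (htraces tK' eF').2).
have mbn : @measurable_fun _ _ (measurableTypeR R) _ D bn.
  by apply/measurable_EFinP; exact: measurable_int ibn.
have imax : mu.-integrable D (EFin \o fun s => Num.max 0 (bn s)).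
  apply: (le_integrable mD _ _ ibn).
    by apply/measurable_EFinP; exact: measurable_maxr.
  move=> s _ /=; rewrite lee_fin; case: (leP 0 (bn s)) => //.
  by rewrite normr0.
have imin : mu.-integrable D (EFin \o fun s => Num.min 0 (bn s)).
  apply: (le_integrable mD _ _ ibn).
    by apply/measurable_EFinP; exact: measurable_minr.
  move=> s _ /=; rewrite lee_fin; case: (leP 0 (bn s)) => //.
  by rewrite normr0.
pose u s := Num.max 0 (bn s) * q j K' (edge_point F s) +
  Num.min 0 (bn s) * q j K (edge_point F s).
have iu : mu.-integrable D (EFin \o u).
  have := integrableD mD (integrable_affine_edge F mD D01 (aq j K') imax)
    (integrable_affine_edge F mD D01 (aq j K) imin).
  by apply: eq_integrable.
pose w i x := q i K' x + -1 * q i K x.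
have aw i : affine (w i) by apply: affineD => //; exact: affineZ.
have fE i s : s \in D -> upwind beta (nrm F) (phi j) (edge_point F s) *
    - jump (nrm F) (phi i) (edge_point F s) = u s * w i (edge_point F s).
  move=> /in01 s01; rewrite /upwind bnE /jump !up// !dn// /u /w; ring.
rewrite -Rintegral_sum//; last first.
  move=> i _; have := integrable_affine_edge F mD D01 (aw i) iu.
  by apply: eq_integrable => // s sD /=; rewrite -fE.
rewrite (@eq_Rintegral _ _ _ mu D (fun=> 0)) ?Rintegral_cst ?mul0r ?mulr0//.
move=> s sD /=.
rewrite (eq_bigr (fun i => u s * w i (edge_point F s))) => [|i _];
  last exact: fE.
rewrite -mulr_sumr /w big_split/= -mulr_sumr.
rewrite (sum_pieces hM hphi qP _ tK) (sum_pieces hM hphi qP _ tK').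
by rewrite mulr1 subrr mulr0.
Qed.

Lemma closed_bdry (A : set (plane R)) : closed (bdry A).
Proof.
rewrite /bdry setDE; apply: closedI; first exact: closed_closure.
by apply: open_closedC; exact: open_interior.
Qed.

(** The normal trace vanishes almost everywhere on the boundary of [Omega]. *)
Lemma edge_int_no_flux K F p : K \in tri M -> edge_of F K -> affine p ->
  edge_int F (~` bdry Omega) (fun x => normal_trace beta K F x * p x) =
  edge_int F setT (fun x => normal_trace beta K F x * p x).
Proof.
move=> tK eF ap; rewrite /edge_int /line_int; congr (_ * _).
set B := [set s | (~` bdry Omega) _].
have mB : @measurable _ (measurableTypeR R) B.
  by apply: measurable_edge_set; apply: closed_openC; exact: closed_bdry.
rewrite (_ : [set s | setT _] = setT)//.
rewrite setIT Rintegral_mkcondr /Rintegral; congr fine.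
have ig := integrable_affine_edge F (measurable_itv `]0, 1[) (@subset_refl _ _) ap
  (htraces tK eF).2.
pose g (s : measurableTypeR R) := normal_trace beta K F (edge_point F s) *
  p (edge_point F s).
have mg : @measurable_fun _ _ (measurableTypeR R) R `]0, 1[ g.
  by apply/measurable_EFinP; exact: (measurable_int mu ig).
apply: ae_eq_integral => //.
- apply/measurable_EFinP; apply/measurable_restrict => //.
  by apply: measurable_funS mg.
- by apply/measurable_EFinP.
- move: (hflux tK eF); rewrite /ae_edge /ae_segment /ae_eq.
  apply: (@filterS _ _ (ae_filter_ringOfSetsType mu)) => s hs s01 /=.
  rewrite patchE; case: ifPn => //; rewrite notin_setE => /= /contrapT bs.
  by rewrite hs ?mul0r// inE.
Qed.

Hypothesis hdivthm : divergence_theorem M beta.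
Hypothesis hdiv : divergence_free M beta.

(** Both forms reduce to the integrals of beta . n phi_j over the boundaries of
    the triangles: a_h by the divergence theorem, b_h because its restriction to
    interior edges drops only edges without flux. *)
Lemma stiffness_column_sum j :
  \sum_i stiffness Omega beta nrm phi i j = 0.
Proof.
have [aq qE] := qP.
have -> : \sum_i stiffness Omega beta nrm phi i j =
    \sum_i a_form M beta (phi j) (phi i) -
    \sum_i b_form Omega beta nrm (phi j) (phi i).
  by rewrite -sumrB; apply: eq_bigr => i _; rewrite mxE.
rewrite sum_a_form; apply/eqP; rewrite subr_eq0; apply/eqP; rewrite /b_form sumrB.
rewrite [X in _ = _ - X]exchange_big /= [X in _ = _ - X]big1; last first.
  by move=> F iF; exact: sum_upwind.
rewrite subr0 exchange_big /=; apply: eq_bigr => K tK.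
rewrite /boundary_int exchange_big /=.
rewrite (eq_bigr (fun F =>
    edge_int F setT (fun x => normal_trace beta K F x * q j K x))).
  rewrite -[RHS]/(boundary_int K setT (fun F x => normal_trace beta K F x * q j K x)).
  apply: (etrans _ (esym (hdivthm tK (hdiv tK) (aq j K)))).
  transitivity (\int[area]_(x in cell K) dot (beta x) (grad (q j K) x) +
    \int[area]_(x in cell K) (0 * q j K x)); last by reflexivity.
  rewrite (_ : \int[area]_(x in cell K) (0 * q j K x) = 0) ?addr0//.
  under eq_Rintegral do rewrite mul0r.
  by rewrite Rintegral_cst ?mul0r//; exact: measurable_cell.
move=> F eF; rewrite sum_edge_traces//; first exact: edge_int_no_flux.
by apply: closed_openC; exact: closed_bdry.
Qed.

End column_sums.

Theorem theorem4p5 (R : realType)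
    (Omega : set (plane R)) (hOmega : polygonal_domain Omega)
    (M : mesh R) (hM : triangulation M Omega)
    (nrm : 'I_(nvert M) * 'I_(nvert M) -> plane R)
    (hnrm : forall F, F \in edges M -> unit_normal F (nrm F))
    (phi : 'I_(nedges M) -> plane R -> R) (hphi : cr_basis nrm phi)
    (t : nat -> R) (ht : forall n, t n < t n.+1)
    (beta : R -> plane R -> plane R)
    (hbounded : forall n, bounded_measurable Omega (beta (t n)))
    (htraces : forall n, has_normal_traces M (beta (t n)))
    (hdivthm : forall n, divergence_theorem M (beta (t n)))
    (hflux : forall n, no_flux M Omega (beta (t n)))
    (hdiv : forall n, divergence_free M (beta (t n)))
    (hcont : forall n, normal_continuous (beta (t n)) nrm)
    (V : nat -> 'M[R]_(nedges M))
    (hVsym : forall n i j, V n i j = V n j i)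
    (hVrow : forall n i, \sum_j V n i j = 0)
    (U : nat -> 'cV[R]_(nedges M))
    (hU : forall n, U n.+1 =
      (1%:M - (t n.+1 - t n) *:
         (invmx (lumped_mass phi) *m
            (stiffness Omega (beta (t n)) nrm phi - V n))) *m U n) :
  forall n, \int[area]_(x in Omega) discrete_fun phi (U n) x =
            \int[area]_(x in Omega) discrete_fun phi (U 0%N) x.
Proof.
have [q qP] := pieces_exist hphi.
suff step n : \int[area]_(x in Omega) discrete_fun phi (U n.+1) x =
              \int[area]_(x in Omega) discrete_fun phi (U n) x.
  by elim=> // n <-; exact: step.
(* left multiplication by e sums the entries of a column vector *)
pose e : 'rV[R]_(nedges M) := const_mx 1.
have massE W : \int[area]_(x in Omega) discrete_fun phi W x =
    (e *m lumped_mass phi *m W) 0 0.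
  apply: (etrans (integral_discrete_fun hOmega hM hphi qP W)).
  rewrite (lumped_massE hM hphi qP) !mxE.
  apply: eq_bigr => i _; congr (_ * _).
  by rewrite mul_mx_diag !mxE mul1r.
have unitD : lumped_mass phi \in unitmx.
  rewrite (lumped_massE hM hphi qP) unitmxE det_diag unitfE.
  apply/prodf_neq0 => i _; rewrite mxE gt_eqF//.
  exact: (mass_gt0 hM).
rewrite !massE hU; set L := lumped_mass phi in unitD *.
set W := stiffness _ _ _ _ - _.
have eW : e *m W = 0.
  apply/rowP => j; rewrite !mxE.
  transitivity (\sum_i stiffness Omega (beta (t n)) nrm phi i j - \sum_i V n i j).
    by rewrite -sumrB; apply: eq_bigr => i _; rewrite !mxE mul1r.
  rewrite (stiffness_column_sum hOmega hM hnrm hphi qP)//.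
  by under eq_bigr do rewrite hVsym; rewrite hVrow subrr.
have eLW : e *m L *m (invmx L *m W) = 0.
  by rewrite -mulmxA (mulmxA L) mulmxV// mul1mx.
by rewrite mulmxA mulmxBr mulmx1 -scalemxAr eLW scaler0 subr0.
Qed.
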